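(* Let $f\in\mathcal{N}_\Psi(\Omega)$ be fixed, observations noiseless ($y_k=f(x_k)$), $x_1,\dots,x_n$ i.i.d. uniform on $\Omega$, $\hat\mu_n\asymp n^\alpha$ with $\alpha<1$, and $\Psi$ satisfying the spectral condition. Then for all $n$, with probability at least $1-C_1\exp(-C_2n^{\eta_1})$, $$\|f-\hat f_n\|_{L_\infty(\Omega)}^2\le C_3\max\Big(n^{(\alpha-1)(1-\frac{d}{2\nu})},\,n^{-(1-\frac{d}{2\nu})}\Big),$$ where $C_1,C_2,C_3,\eta_1>0$ depend on $\Psi,\Omega,f$.
   Context: $\Omega\subset\mathbb{R}^d$ convex and compact with positive Lebesgue measure. $\Psi$ stationary, strictly positive definite, integrable, $\Psi(0)=1$, with spectral density $f_\Psi$ ($\Psi(h)=\int e^{i\omega^Th}f_\Psi(\omega)d\omega$) satisfying $c_1(1+\|\omega\|_2^2)^{-\nu}\le f_\Psi(\omega)\le c_2(1+\|\omega\|_2^2)^{-\nu}$ ($c_2\ge c_1>0$, $\nu>d/2$). $\mathcal{N}_\Psi(\Omega)$ is the RKHS of $\Psi$ on $\Omega$. $\hat\mu_n>0$ deterministic; $Y=(f(x_k))_k$; $r(x)=(\Psi(x-x_k))_k$, $R=(\Psi(x_j-x_k))_{jk}$; $\hat f_n(x)=r(x)^T(R+\hat\mu_nI_n)^{-1}Y$. *)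

(* Defs.v *)
From HB Require Import structures.
From mathcomp Require Import all_boot all_order all_algebra.
From mathcomp Require Import all_classical all_reals all_analysis.
Set Implicit Arguments. Unset Strict Implicit. Unset Printing Implicit Defensive.
Import Order.TTheory GRing.Theory Num.Theory.
Import numFieldNormedType.Exports.
Local Open Scope classical_set_scope.
Local Open Scope ring_scope.

Section Defs.
Variable R : realType.

Definition box (iota : finType) (a b : iota -> R) : set (iota -> R) :=
  [set x | forall i, a i <= x i <= b i].
Definition boxvol (iota : finType) (a b : iota -> R) : R := \prod_i (b i - a i).

(* Lebesgue outer measure: infimum of the total volume of countable (finite or
   infinite: only the boxes with u k = true are used) box covers *)
Definition leb_outer (iota : finType) (A : set (iota -> R)) : \bar R :=
  ereal_inf [set s : \bar R | exists (u : nat -> bool) (a b : nat -> iota -> R),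
    [/\ (forall k i, a k i <= b k i),
        A `<=` \bigcup_(k in [set k | u k]) box (a k) (b k) &
        s = (\sum_(0 <= k <oo) (if u k then boxvol (a k) (b k) else 0)%:E)%E]].

Definition coordV (d : nat) (x : 'rV[R]_d) : 'I_d -> R := fun i => x ord0 i.
Definition lebV (d : nat) (A : set 'rV[R]_d) : \bar R := leb_outer (@coordV d @` A).

(* an n-sample (x_1,...,x_n) of points of R^d, seen as a point of R^(n*d);
   lebS is the Lebesgue outer measure on (R^d)^n *)
Definition coordS (n d : nat) (X : 'I_n -> 'rV[R]_d) : ('I_n * 'I_d)%type -> R :=
  fun p => X p.1 ord0 p.2.
Definition lebS (n d : nat) (A : set ('I_n -> 'rV[R]_d)) : \bar R :=
  leb_outer (@coordS n d @` A).

Definition leb_measurable_set (d : nat) (A : set 'rV[R]_d) : Prop :=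
  (@lebV d).-caratheodory A.
Definition leb_measurable_fun (d : nat) (g : 'rV[R]_d -> R) : Prop :=
  forall t : R, leb_measurable_set [set x | t < g x].

Definition nnint (d : nat) (h : 'rV[R]_d -> \bar R) : \bar R :=
  ereal_sup [set s : \bar R | exists (k : nat) (c : 'I_k -> R) (E : 'I_k -> set 'rV[R]_d),
    [/\ (forall j, 0 <= c j),
        (forall j, leb_measurable_set (E j)),
        (forall x, ((\sum_j c j * \1_(E j) x)%:E <= h x)%E) &
        s = (\sum_j (c j)%:E * lebV (E j))%E]].

Definition lint (d : nat) (g : 'rV[R]_d -> R) : \bar R :=
  (nnint (fun x => (Num.max (g x) 0)%:E) - nnint (fun x => (Num.max (- g x) 0)%:E))%E.

Definition leb_integrable (d : nat) (g : 'rV[R]_d -> R) : Prop :=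
  leb_measurable_fun g /\ (nnint (fun x => `|g x|%:E) < +oo)%E.

Definition dotV (d : nat) (u v : 'rV[R]_d) : R := \sum_i u ord0 i * v ord0 i.
Definition sqnorm2 (d : nat) (u : 'rV[R]_d) : R := \sum_i (u ord0 i) ^+ 2.

Definition convex_set_Rd (d : nat) (Om : set 'rV[R]_d) : Prop :=
  forall x y t, Om x -> Om y -> 0 <= t <= 1 -> Om (t *: x + (1 - t) *: y).

Definition strictly_pos_def (d : nat) (Psi : 'rV[R]_d -> R) : Prop :=
  forall (m : nat) (x : 'I_m -> 'rV[R]_d) (a : 'I_m -> R),
    injective x -> (exists j, a j != 0) ->
    0 < \sum_j \sum_k a j * a k * Psi (x j - x k).

(* fPsi is a spectral density of Psi:  Psi(h) = int e^{i w^T h} fPsi(w) dw,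
   written out in real and imaginary parts (Psi is real valued) *)
Definition spectral_density (d : nat) (Psi fPsi : 'rV[R]_d -> R) : Prop :=
  leb_measurable_fun fPsi /\
  forall h : 'rV[R]_d,
    lint (fun w => cos (dotV w h) * fPsi w) = (Psi h)%:E /\
    lint (fun w => sin (dotV w h) * fPsi w) = 0%E.

(* functions on Omega are represented as functions on R^d vanishing off Omega *)
Definition restr0 (d : nat) (Om : set 'rV[R]_d) (g : 'rV[R]_d -> R) : 'rV[R]_d -> R :=
  patch (fun=> 0) Om g.

Record is_RKHS (d : nat) (Om : set 'rV[R]_d) (Psi : 'rV[R]_d -> R)
    (H : set ('rV[R]_d -> R)) (ip : ('rV[R]_d -> R) -> ('rV[R]_d -> R) -> R) : Prop := {
  rkhs_supp : forall g, H g -> forall y, ~ Om y -> g y = 0;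
  rkhs_zero : H (fun=> 0);
  rkhs_lin : forall a g h, H g -> H h -> H (fun y => a * g y + h y);
  rkhs_ip_lin : forall a g h k, H g -> H h -> H k ->
     ip (fun y => a * g y + h y) k = a * ip g k + ip h k;
  rkhs_ip_sym : forall g h, H g -> H h -> ip g h = ip h g;
  rkhs_ip_pos : forall g, H g -> g <> (fun=> 0) -> 0 < ip g g;
  rkhs_complete : forall u : nat -> 'rV[R]_d -> R, (forall k, H (u k)) ->
     (forall e, 0 < e -> exists N, forall m k, (N <= m)%N -> (N <= k)%N ->
        ip (fun y => u m y - u k y) (fun y => u m y - u k y) < e) ->
     exists g, H g /\ (forall e, 0 < e -> exists N, forall k, (N <= k)%N ->
        ip (fun y => u k y - g y) (fun y => u k y - g y) < e);
  rkhs_kernel : forall x, Om x -> H (restr0 Om (fun y => Psi (y - x)));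
  rkhs_reprod : forall x g, Om x -> H g -> ip g (restr0 Om (fun y => Psi (y - x))) = g x }.

Definition in_native_space (d : nat) (Om : set 'rV[R]_d) (Psi : 'rV[R]_d -> R)
    (f : 'rV[R]_d -> R) : Prop :=
  exists H ip, is_RKHS Om Psi H ip /\ H (restr0 Om f).

Definition krr_estimator (d n : nat) (Psi : 'rV[R]_d -> R) (mu : R)
    (f : 'rV[R]_d -> R) (X : 'I_n -> 'rV[R]_d) (x : 'rV[R]_d) : R :=
  let Rm := \matrix_(j < n, k < n) Psi (X j - X k) in
  let r := \row_(k < n) Psi (x - X k) in
  let Y := \col_(k < n) f (X k) in
  (r *m invmx (Rm + mu%:M) *m Y) ord0 ord0.

Definition linf_norm (d : nat) (Om : set 'rV[R]_d) (g : 'rV[R]_d -> R) : \bar R :=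
  ereal_inf [set M : \bar R | lebV [set x | Om x /\ (M < (`|g x|)%:E)%E] = 0%E].

End Defs.

(* Main.v *)
Require Import Defs.
From HB Require Import structures.
From mathcomp Require Import all_boot all_order all_algebra finmap.
From mathcomp Require Import all_classical all_reals all_analysis.
From mathcomp Require Import measurable_realfun.
From mathcomp Require Import lra ring.
Set Implicit Arguments. Unset Strict Implicit. Unset Printing Implicit Defensive.
Import Order.TTheory GRing.Theory Num.Theory.
Import numFieldNormedType.Exports.
Local Open Scope classical_set_scope.
Local Open Scope ring_scope.

(** With [e = f - fhat], the normal equations give [||e||^2 <= ||f||^2] and
    [sum_k e(x_k)^2 <= mu ||f||^2] in the native space. Put
    [rho = n^(beta/(2 nu))] with [beta = max(alpha - 1, -1)].

    Near a point [x] of [Om] the homothetic copy [(1 - rho) b + rho Om] of the convex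
    set [Om], with [|x - b| <= rho], contains cubes of side of order [rho] such that
    any choice of one point [z_k] in each cube admits bounded weights [w_k]
    reproducing polynomials of degree [< m], [m >= nu], at [x]. Hence, in Fourier
    variables, the functional [delta_x - sum_k w_k delta_(z_k)] has squared norm
    [int fPsi |.|^2 <= C int fPsi(w) min(1, |rho w|^(2m)) dw]
    [<= C' rho^(2 nu) int fPsi(rho w) dw = C' rho^(2 nu - d)]; both bounds on [fPsi]
    enter in the last inequality.

    By a Chernoff bound every cube of a polynomially large family contains at least
    of the order of [n rho^d] sample points, except on an event of probability
    [O(exp(- c n rho^d))]. Taking for [z_k] the sample point where [e^2] is smallest
    gives [e(z_k)^2 <= C mu ||f||^2 / (n rho^d)], whence
    [e(x)^2 <= C rho^(2 nu - d)]. *)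

(** Volumes are outer measures given by box covers, on [R^d] and on [(R^d)^n], and the failure event
    is not known to be measurable. The probability statement is therefore reduced to two one-sided
    estimates: an upper bound for product sets, used with the union bound, and the lower bound
    [lebV Om ^ n] for the whole sample space.

    The cut-off [-1] in [beta] keeps [rho^-d <= n] and leaves [n rho^d] a positive power of [n],
    since [d < 2 nu]; [alpha - 1 <= beta] keeps [mu] at most of order [n rho^(2 nu)], which balances
    the two error terms.

    Convexity serves twice: it puts a cube inside [Om], and it lets one configuration of cubes,
    fixed in advance, be shrunk towards any point of [Om], boundary included, without leaving [Om].
    This is why the constants are uniform. The weights come from tensor Lagrange interpolation on a
    grid: small cubes keep the collocation matrix close to the identity. The target may lie far from
    the cubes, where only a bound on the Lagrange basis is used. The centres [b] run through a
    finite net, so that the good event does not depend on [x]. *)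

(** * Outer measure from countable box covers *)

Section BoxOuterMeasure.
Variables (R : realType) (iota : finType).
Implicit Types A : set (iota -> R).
Local Open Scope ereal_scope.

Definition weight (u : bool) (a b : iota -> R) : \bar R :=
  (if u then boxvol a b else 0)%:E.

Definition box_cover A (u : nat -> bool) (a b : nat -> iota -> R) :=
  (forall k i, (a k i <= b k i)%R) /\
  A `<=` \bigcup_(k in [set k | u k]) box (a k) (b k).

Lemma boxvol_ge0 (a b : iota -> R) :
  (forall i, (a i <= b i)%R) -> (0 <= boxvol a b)%R.
Proof. by move=> ab; apply: prodr_ge0 => i _; rewrite subr_ge0. Qed.

Lemma weight_ge0 u (a b : iota -> R) :
  (forall i, (a i <= b i)%R) -> 0 <= weight u a b.
Proof. by move=> ab; rewrite /weight lee_fin; case: u => //; exact: boxvol_ge0. Qed.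

Lemma leb_outer_ge0 A : 0 <= leb_outer A.
Proof.
apply: le_ereal_inf_tmp => _ [u [a [b [ab _ ->]]]].
by apply: nneseries_ge0 => k _ _; exact: weight_ge0.
Qed.

Lemma leb_outer_cover A u a b : box_cover A u a b ->
  leb_outer A <= \sum_(0 <= k <oo) weight (u k) (a k) (b k).
Proof. by move=> [ab sA]; apply: ereal_inf_lbound; exists u, a, b. Qed.

Lemma leb_outer_glb A (r : \bar R) :
  (forall u a b, box_cover A u a b ->
     r <= \sum_(0 <= k <oo) weight (u k) (a k) (b k)) -> r <= leb_outer A.
Proof.
move=> H; apply: le_ereal_inf_tmp => _ [u [a [b [ab sA ->]]]].
exact: H.
Qed.

Lemma leb_outer_cover_eps A (e : R) : leb_outer A \is a fin_num -> (0 < e)%R ->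
  exists u a b, box_cover A u a b /\
    \sum_(0 <= k <oo) weight (u k) (a k) (b k) <= leb_outer A + e%:E.
Proof.
move=> fA e0; have [_ [u [a [b [ab sA ->]]]] /ltW h] := lb_ereal_inf_adherent e0 fA.
by exists u, a, b.
Qed.

Lemma leb_outer0 : leb_outer (set0 : set (iota -> R)) = 0.
Proof.
apply/eqP; rewrite eq_le leb_outer_ge0 andbT.
apply: le_trans (@leb_outer_cover set0 (fun=> false) (fun _ _ => 0%R) (fun _ _ => 0%R) _) _.
  by split=> // x.
by rewrite eseries0.
Qed.

Lemma le_leb_outer : {homo @leb_outer R iota : A B / A `<=` B >-> A <= B}.
Proof.
move=> A B AB; apply: leb_outer_glb => u a b [ab sB].
by apply: leb_outer_cover; split=> // x /AB/sB.
Qed.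

Lemma leb_outer_box (a b : iota -> R) : (forall i, (a i <= b i)%R) ->
  leb_outer (box a b) <= (boxvol a b)%:E.
Proof.
move=> ab; apply: le_trans
  (@leb_outer_cover _ (fun k => k == 0%N) (fun=> a) (fun=> b) _) _.
  by split=> // x xab; exists 0%N.
rewrite (nneseries_recl (fun k _ => weight_ge0 (k == 0%N) ab))//.
by rewrite [X in _ + X]eseries0 ?adde0// => -[].
Qed.

Lemma nneseries_pair (w : nat -> nat -> \bar R) (f : nat -> nat * nat) :
  (forall i j, 0 <= w i j) -> set_bij setT setT f ->
  \sum_(0 <= k <oo) w (f k).1 (f k).2 = \sum_(0 <= i <oo) \sum_(0 <= j <oo) w i j.
Proof.
move=> w0 bf; rewrite nneseries_esumT//.
rewrite -(reindex_esum setT setT f (fun p => w p.1 p.2))//.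
rewrite [RHS]nneseries_esumT; last by move=> i; exact: nneseries_ge0.
transitivity (\esum_(i in [set: nat]) \esum_(j in [set: nat]) w i j); last first.
  by apply: eq_esum => i _; rewrite nneseries_esumT.
rewrite esum_esum//; congr esum.
by apply/seteqP; split.
Qed.

Lemma leb_outer_sigma_subadditive : sigma_subadditive (@leb_outer R iota).
Proof.
move=> A; have [[i ioo]|] := pselect (exists i, leb_outer (A i) = +oo).
  rewrite (eseries_pinfty _ _ ioo) ?leey// => n _.
  by rewrite -ltNye (lt_le_trans _ (leb_outer_ge0 _)).
rewrite -forallNE => Aoo.
have fA n : leb_outer (A n) \is a fin_num.
  by rewrite ge0_fin_numE ?leb_outer_ge0// ltey; apply/eqP.
apply/lee_addgt0Pr => e e0.
rewrite (le_trans _ (epsilon_trick _ _ _))//; last 2 first.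
- by move=> n; exact: leb_outer_ge0.
- exact: ltW.
have en n : (0 < e / (2 ^ n.+1)%:R)%R by rewrite divr_gt0// ltr0n expn_gt0.
pose P n (g : nat -> bool * (iota -> R) * (iota -> R)) :=
  box_cover (A n) (fun k => (g k).1.1) (fun k => (g k).1.2) (fun k => (g k).2) /\
  \sum_(0 <= k <oo) weight (g k).1.1 (g k).1.2 (g k).2 <=
    leb_outer (A n) + (e / (2 ^ n.+1)%:R)%:E.
have [G PG] : {G & forall n, P n (G n)}.
  apply: (@choice _ _ P) => n.
  have [u [a [b [cv hs]]]] := leb_outer_cover_eps (fA n) (en n).
  by exists (fun k => (u k, a k, b k)).
(* The countably many covers are merged into one sequence along a bijection of [nat] with
   [nat * nat]. *)
have /card_esym/ppcard_eqP[f] := card_nat2.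
pose g k := G (f k).1 (f k).2.
apply: le_trans (@leb_outer_cover _ (fun k => (g k).1.1) (fun k => (g k).1.2)
  (fun k => (g k).2) _) _.
  split; first by move=> k i; exact: (PG _).1.1.
  move=> x [n _ /(PG n).1.2 [k /= uk xk]]; exists (f^-1%FUN (n, k)) => /=;
  by rewrite /g invK ?inE.
rewrite (@nneseries_pair (fun i j => weight (G i j).1.1 (G i j).1.2 (G i j).2)); last 2 first.
- by move=> i j; apply: weight_ge0 => k; exact: (PG i).1.1.
- exact: bij.
apply: lee_nneseries => [n _ _|n _]; last exact: (PG n).2.
by apply: nneseries_ge0 => k _ _; apply: weight_ge0 => i; exact: (PG n).1.1.
Qed.

End BoxOuterMeasure.

(** * Lebesgue outer measure on row vectors: measurable half-spaces and dilations *)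

Section LebesgueOnVectors.
Variables (R : realType) (d : nat).
Implicit Types (A : set 'rV[R]_d) (u : nat -> bool) (a b : nat -> 'I_d -> R).
Local Open Scope ereal_scope.

Definition vbox (a b : 'I_d -> R) : set 'rV[R]_d :=
  [set x | forall i, (a i <= x ord0 i <= b i)%R].

Definition vbox_cover A u a b :=
  (forall k i, (a k i <= b k i)%R) /\
  A `<=` \bigcup_(k in [set k | u k]) vbox (a k) (b k).

Lemma lebV_cover A u a b : vbox_cover A u a b ->
  lebV A <= \sum_(0 <= k <oo) weight (u k) (a k) (b k).
Proof.
move=> [ab sA]; apply: leb_outer_cover; split=> // _ [x /sA[k uk xk] <-].
by exists k.
Qed.

Lemma lebV_glb A (r : \bar R) :
  (forall u a b, vbox_cover A u a b ->
     r <= \sum_(0 <= k <oo) weight (u k) (a k) (b k)) -> r <= lebV A.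
Proof.
move=> H; apply: leb_outer_glb => u a b [ab sA]; apply: H; split=> // x Ax.
have [|k uk xk] := sA (coordV x); first by exists x.
by exists k.
Qed.

Lemma lebV0 : lebV (set0 : set 'rV[R]_d) = 0.
Proof. by rewrite /lebV image_set0 leb_outer0. Qed.

Lemma lebV_ge0 A : 0 <= lebV A.
Proof. exact: leb_outer_ge0. Qed.

Lemma le_lebV : {homo @lebV R d : A B / A `<=` B >-> A <= B}.
Proof. by move=> A B AB; apply: le_leb_outer; exact: image_subset. Qed.

Lemma lebV_sigma_subadditive : sigma_subadditive (@lebV R d).
Proof. by move=> F; rewrite /lebV image_bigcup; exact: leb_outer_sigma_subadditive. Qed.

HB.instance Definition _ := isOuterMeasure.Build R 'rV[R]_d (@lebV R d)
  lebV0 lebV_ge0 le_lebV lebV_sigma_subadditive.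

Lemma lebV_box (a b : 'I_d -> R) : (forall i, (a i <= b i)%R) ->
  lebV (vbox a b) <= (boxvol a b)%:E.
Proof.
move=> ab; apply: le_trans (leb_outer_box ab); apply: le_leb_outer.
by move=> _ [x xab <-].
Qed.

(** Cutting each box of a cover along the hyperplane [x_i = t] gives two boxes with the same total
    volume, hence covers of the two parts of the test set at no extra cost. *)
Lemma leb_measurable_coord (i : 'I_d) :
  leb_measurable_fun (fun x : 'rV[R]_d => x ord0 i).
Proof.
move=> t; apply: le_caratheodory_measurable => X.
apply: lebV_glb => u a b [ab sX].
(* [t] clamped to the side [[a k i, b k i]]: when the hyperplane misses the box, one piece is flat
   instead of having reversed bounds. *)
pose c k := Num.max (a k i) (Num.min (b k i) t).
have ac k : (a k i <= c k)%R by rewrite le_max lexx.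
have cb k : (c k <= b k i)%R by rewrite ge_max ab ge_min lexx.
pose a1 k j := if j == i then c k else a k j.
pose b2 k j := if j == i then c k else b k j.
have a1b k j : (a1 k j <= b k j)%R by rewrite /a1; case: eqP => [->|].
have ab2 k j : (a k j <= b2 k j)%R by rewrite /b2; case: eqP => [->|].
have -> : \sum_(0 <= k <oo) weight (u k) (a k) (b k) =
    \sum_(0 <= k <oo) weight (u k) (a1 k) (b k) +
    \sum_(0 <= k <oo) weight (u k) (a k) (b2 k).
  rewrite -nneseriesD; last 2 first.
  - by move=> *; exact: weight_ge0.
  - by move=> *; exact: weight_ge0.
  apply: eq_eseriesr => k _; rewrite /weight; case: (u k); last by rewrite adde0.
  rewrite -EFinD /boxvol; congr EFin.
  rewrite (bigD1 i)//= (bigD1 i (P := xpredT) (F := fun j => b k j - a1 k j)%R)//=.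
  rewrite (bigD1 i (P := xpredT) (F := fun j => b2 k j - a k j)%R)//=.
  rewrite /a1 /b2 !eqxx.
  under [in RHS]eq_bigr => j /negbTE -> do [].
  under [X in _ = (_ + _ * X)%R]eq_bigr => j /negbTE -> do [].
  by rewrite -mulrDl; congr *%R; ring.
apply: leeD; apply: lebV_cover; split=> // x [Xx /= xt].
  have [k uk xk] := sX _ Xx; exists k => // j; rewrite /a1.
  case: eqP => [->|_]; last exact: xk.
  have /andP[h1 h2] := xk i; rewrite h2 andbT ge_max h1/= ge_min (ltW xt) orbT.
  by [].
have [k uk xk] := sX _ Xx; exists k => // j; rewrite /b2.
case: eqP => [->|_]; last exact: xk.
have /andP[h1 h2] := xk i; rewrite h1 /= le_max le_min h2 /=.
by move/negP : xt; rewrite -leNgt => ->; rewrite orbT.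
Qed.

Definition affine_image (v : 'rV[R]_d) (t : R) A : set 'rV[R]_d :=
  [set (v + t *: x)%R | x in A].

Lemma affine_imageK v (t : R) A : t != 0%R ->
  affine_image (- (t^-1 *: v))%R t^-1 (affine_image v t A) = A.
Proof.
move=> t0; have E x : (- (t^-1 *: v) + t^-1 *: (v + t *: x) = x)%R.
  by rewrite scalerDr scalerA mulVf// scale1r addKr.
apply/seteqP; split=> [_ [_ [x Ax <-] <-]|x Ax]; first by rewrite E.
by exists (v + t *: x)%R; [exists x|rewrite E].
Qed.

Let lebV_affine_le v (t : R) A : (0 < t)%R ->
  (t ^- d)%:E * lebV (affine_image v t A) <= lebV A.
Proof.
move=> t0; apply: lebV_glb => u a b [ab sA].
rewrite lee_pdivrMl ?exprn_gt0// -nneseriesZl; last by move=> *; exact: weight_ge0.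
apply: le_trans (@lebV_cover _ u (fun k i => v ord0 i + t * a k i)%R
  (fun k i => v ord0 i + t * b k i)%R _) _.
  split=> [k i|_ [x /sA[k uk xk] <-]]; first by rewrite lerD2l ler_pM2l.
  by exists k => // i; rewrite !mxE !lerD2l !ler_pM2l// xk.
apply: lee_nneseries => [k _ _|k _].
  by apply: weight_ge0 => i; rewrite lerD2l ler_pM2l.
rewrite /weight -EFinM lee_fin; case: (u k); last by rewrite mulr0.
rewrite /boxvol (eq_bigr (fun i => t * (b k i - a k i))%R); last by move=> i _; ring.
by rewrite big_split/= prodr_const card_ord.
Qed.

(** Transporting covers gives one inequality; the other is the same inequality for the inverse
    map. *)
Lemma lebV_affine v (t : R) A : (0 < t)%R ->
  lebV (affine_image v t A) = (t ^+ d)%:E * lebV A.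
Proof.
move=> t0; apply/eqP; rewrite eq_le; apply/andP; split.
  by rewrite -lee_pdivrMl ?exprn_gt0//; exact: lebV_affine_le.
have := @lebV_affine_le (- (t^-1 *: v))%R t^-1 (affine_image v t A).
by rewrite invr_gt0 t0 affine_imageK ?gt_eqF// exprVn invrK; apply.
Qed.

Lemma affine_imageI v (t : R) A B : t != 0%R ->
  affine_image v t (A `&` B) = affine_image v t A `&` affine_image v t B.
Proof.
move=> t0; apply/seteqP; split=> [_ [x [Ax Bx] <-]|]; first by split; exists x.
move=> _ [[x Ax <-] [y By /addrI/(scalerI t0) yx]].
by exists x => //; split=> //; rewrite -yx.
Qed.

Lemma affine_imageC v (t : R) A : t != 0%R ->
  affine_image v t (~` A) = ~` affine_image v t A.
Proof.
move=> t0; apply/seteqP; split=> [_ [x Ax <-] [y Ay /addrI/(scalerI t0) yx]|y Ay].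
  by apply: Ax; rewrite -yx.
exists (t^-1 *: (y - v))%R; last by rewrite scalerA divff// scale1r addrC subrK.
move=> Ax; apply: Ay; exists (t^-1 *: (y - v))%R => //.
by rewrite scalerA divff// scale1r addrC subrK.
Qed.

(** A test set is pulled back by the inverse map, split by [A] and pushed forward; the factor
    [t ^+ d] is common to all terms. *)
Lemma leb_measurable_affine v (t : R) A : (0 < t)%R ->
  leb_measurable_set A -> leb_measurable_set (affine_image v t A).
Proof.
move=> t0 mA X; have tn0 : t != 0%R by rewrite gt_eqF.
pose X' := affine_image (- (t^-1 *: v))%R t^-1 X.
have -> : X = affine_image v t X'.
  rewrite -[LHS](@affine_imageK (- (t^-1 *: v)) t^-1)%R ?invr_neq0// invrK.
  by rewrite scalerN scalerA divff// scale1r opprK.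
transitivity ((t ^+ d)%:E * (lebV (X' `&` A) + lebV (X' `&` ~` A))).
  by rewrite lebV_affine//; congr (_ * _); exact: mA.
rewrite ge0_muleDr ?lebV_ge0// -!(@lebV_affine v)//.
by rewrite !affine_imageI// affine_imageC.
Qed.

(** Change of variables carried out on simple functions: the sets of one lying below the dilated [h]
    are themselves dilated, and the result lies below [h]. *)
Lemma nnint_scale (h : 'rV[R]_d -> \bar R) (t : R) : (0 < t)%R ->
  nnint (fun x => h (t *: x)%R) <= (t ^- d)%:E * nnint h.
Proof.
move=> t0; apply: ge_ereal_sup => _ [k [c [E [c0 mE cE ->]]]].
rewrite muleC lee_pdivlMr ?exprn_gt0// muleC; apply: ereal_sup_ubound.
exists k, c, (fun j => affine_image 0 t (E j)); split=> //.
- by move=> j; exact: leb_measurable_affine.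
- move=> x; have := cE (t^-1 *: x)%R.
  rewrite scalerA divff ?gt_eqF// scale1r; apply: le_trans.
  rewrite lee_fin; apply: ler_sum => j _; rewrite ler_wpM2l// !indicE.
  case: (boolP (x \in _)) => //; rewrite !inE => -[y Ey].
  rewrite add0r => <-; rewrite scalerA mulVf ?gt_eqF// scale1r.
  by rewrite mem_set.
- rewrite ge0_sume_distrr; last by move=> j _; rewrite mule_ge0 ?lebV_ge0// lee_fin.
  by apply: eq_bigr => j _; rewrite lebV_affine// muleCA.
Qed.

End LebesgueOnVectors.

(** * From suprema over simple functions to integrals *)

Section SimpleFunctionIntegral.
Import HBSimple HBNNSimple.
Context (disp : measure_display) (T : measurableType disp) (R : realType).
Variable mu : {measure set T -> \bar R}.
Local Open Scope ereal_scope.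

Lemma integral_simple (k : nat) (c : 'I_k -> R) (E : 'I_k -> set T) :
  (forall j, (0 <= c j)%R) -> (forall j, measurable (E j)) ->
  \int[mu]_x (\sum_j (c j * \1_(E j) x))%:E = \sum_j (c j)%:E * mu (E j).
Proof.
move=> c0 mE.
have m1 j : measurable_fun [set: T] (fun x => (\1_(E j) x : R)%:E).
  by apply/measurable_EFinP/measurable_indic.
under eq_integral do rewrite -sumEFin.
rewrite ge0_integral_sum//.
- apply: eq_bigr => j _.
  under eq_integral do rewrite EFinM.
  rewrite ge0_integralZl ?lee_fin//.
  by rewrite integral_indic// setIT.
- by move=> j; apply/measurable_EFinP/measurable_funM.
- by move=> j x _; rewrite lee_fin mulr_ge0.
Qed.

(** Identifies the supremum behind [nnint] with the integral. For the second inequality a simple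
    function is written on its level sets, indexed by the finite list of its values. *)
Lemma integral_sup_simple (h : T -> \bar R) : (forall x, 0 <= h x) ->
  measurable_fun [set: T] h ->
  ereal_sup [set s : \bar R | exists (k : nat) (c : 'I_k -> R) (E : 'I_k -> set T),
    [/\ (forall j, (0 <= c j)%R), (forall j, measurable (E j)),
        (forall x, (\sum_j c j * \1_(E j) x)%:E <= h x) &
        s = \sum_j (c j)%:E * mu (E j)]] = \int[mu]_x h x.
Proof.
move=> h0 mh; apply/eqP; rewrite eq_le; apply/andP; split.
  apply: ge_ereal_sup => _ [k [c [E [c0 mE cE ->]]]].
  rewrite -integral_simple//; apply: ge0_le_integral => //.
  - by move=> x _; rewrite lee_fin sumr_ge0// => j _; rewrite mulr_ge0.
  - apply/measurable_EFinP; apply: measurable_sum => j.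
    by apply: measurable_funM => //; exact: measurable_indic.
rewrite ge0_integralTE//; apply: ge_ereal_sup => _ [s sh <-].
apply: ereal_sup_ubound.
have fr := @fimfunP _ _ s.
pose t := enum_fset (fset_set (range s)).
exists (size t), (fun j => nth 0%R t j), (fun j => s @^-1` [set nth 0%R t j]).
split.
- move=> j; have : (nth 0%R t j) \in fset_set (range s) by exact: mem_nth.
  by rewrite in_fset_set// inE => -[x _ <-].
- by move=> j; exact: (measurable_sfunP s (measurable_set1 _)).
- move=> x; apply: le_trans (sh x); rewrite lee_fin (fimfunE s x).
  by rewrite fsbig_finite//= (big_nth 0%R) big_mkord.
- by rewrite sintegralE fsbig_finite//= (big_nth 0%R) big_mkord.
Qed.

Lemma measurable_max0 (g : T -> R) : measurable_fun [set: T] g ->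
  measurable_fun [set: T] (fun x => (Num.max (g x) 0)%:E).
Proof. by move=> mg; apply/measurable_EFinP/measurable_maxr. Qed.

Lemma integral_max0B (g : T -> R) : \int[mu]_x (g x)%:E =
  \int[mu]_x (Num.max (g x) 0)%:E - \int[mu]_x (Num.max (- g x) 0)%:E.
Proof.
rewrite integralE; congr (_ - _); apply: eq_integral => x _.
  by rewrite funeposE EFin_max.
by rewrite funenegE EFin_max.
Qed.

(** Markov's inequality for an arbitrary set [A], which is enclosed in a measurable superlevel set
    of [h]. It is applied to the domain [Om] when the coordinates of a sample are integrated out. *)
Lemma markov_outer (h : T -> \bar R) (c : R) (A : set T) : (0 <= c)%R ->
  (forall x, 0 <= h x) -> measurable_fun [set: T] h ->
  (forall x, A x -> c%:E <= h x) ->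
  exists E, [/\ measurable E, A `<=` E & c%:E * mu E <= \int[mu]_x h x].
Proof.
move=> c0 h0 mh cA; exists [set x | c%:E <= h x]; split=> //.
  by rewrite -[X in measurable X]setTI; exact: emeasurable_fun_c_infty.
have mE : measurable [set x | c%:E <= h x].
  by rewrite -[X in measurable X]setTI; exact: emeasurable_fun_c_infty.
rewrite -[X in mu X]setIT -(integral_indic mu measurableT mE).
rewrite -ge0_integralZl ?lee_fin//; last by apply/measurable_EFinP/measurable_indic.
apply: ge0_le_integral => //.
- by move=> x _; rewrite -EFinM lee_fin mulr_ge0.
- apply/measurable_EFinP; apply: measurable_funM => //; exact: measurable_indic.
move=> x _; rewrite indicE; case: (boolP (x \in _)) => [|_].
  by rewrite inE mule1.
by rewrite mule0.
Qed.

Lemma integral_indic_series (c : nat -> R) (E : nat -> set T) :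
  (forall k, (0 <= c k)%R) -> (forall k, measurable (E k)) ->
  measurable_fun [set: T] (fun x => \sum_(0 <= k <oo) (c k * \1_(E k) x)%:E) /\
  \int[mu]_x (\sum_(0 <= k <oo) (c k * \1_(E k) x)%:E) =
  \sum_(0 <= k <oo) (c k)%:E * mu (E k).
Proof.
move=> c0 mE.
have m1 k : measurable_fun [set: T] (fun x => (c k * \1_(E k) x)%:E).
  by apply/measurable_EFinP/measurable_funM => //; exact: measurable_indic.
have p1 k x : 0 <= (c k * \1_(E k) x)%:E by rewrite lee_fin mulr_ge0.
split; first exact: (@ge0_emeasurable_sum _ _ _ _ _ xpredT).
rewrite integral_nneseries//; apply: eq_eseriesr => k _.
under eq_integral do rewrite EFinM.
rewrite ge0_integralZl ?lee_fin//; last by apply/measurable_EFinP/measurable_indic.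
by rewrite integral_indic// setIT.
Qed.

End SimpleFunctionIntegral.

(** * Lebesgue measure on the Caratheodory sets *)

Section LebesgueIntegral.
Variables (R : realType) (d : nat).
Local Notation T := (caratheodory_type (@lebV R d)).
Local Open Scope ereal_scope.

Let lebV_outer : {outer_measure set 'rV[R]_d -> \bar R} := @lebV R d.

(** The underlying function is [lebV] itself, so that statements on one convert to statements on the
    other; only the carrier changes, to the type whose measurable sets are the Caratheodory sets. *)
Definition lamV : {measure set T -> \bar R} :=
  (lebV_outer : set (caratheodory_type lebV_outer) -> \bar R).

Lemma leb_measurable_funP (g : 'rV[R]_d -> R) :
  leb_measurable_fun g -> measurable_fun [set: T] (g : T -> R).
Proof.
move=> mg _; apply: (measurability _ (RGenOInfty.measurableE R)) => //.
by move=> /= _ [_ [a ->] <-]; rewrite preimage_itvoy setTI; exact: mg.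
Qed.

Lemma measurable_coord (i : 'I_d) :
  measurable_fun [set: T] (fun x : T => (x : 'rV[R]_d) ord0 i).
Proof. exact/leb_measurable_funP/leb_measurable_coord. Qed.

Lemma measurable_dotV (h : 'rV[R]_d) :
  measurable_fun [set: T] (fun x : T => dotV (x : 'rV[R]_d) h).
Proof.
apply: measurable_sum => i.
by apply: measurable_funM; [exact: measurable_coord|exact: measurable_cst].
Qed.

Lemma measurable_vbox (a b : 'I_d -> R) : measurable (vbox a b : set T).
Proof.
have -> : vbox a b = \bigcap_(i in [set: 'I_d])
    (((fun x : T => (x : 'rV[R]_d) ord0 i) @^-1` `[a i, b i]%classic) : set T).
  apply/seteqP; split=> [x xab|x /= H] i; first by rewrite /= in_itv /= xab.
  by have := H i Logic.I; rewrite /= in_itv /=.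
apply: fin_bigcap_measurable => // i _.
by rewrite -[X in measurable X]setTI; apply: measurable_coord.
Qed.

Lemma nnint_integral (h : 'rV[R]_d -> \bar R) : (forall x, 0 <= h x) ->
  measurable_fun [set: T] (h : T -> \bar R) -> nnint h = \int[lamV]_x h x.
Proof. exact: (@integral_sup_simple _ _ _ lamV). Qed.

Lemma lint_integral (g : 'rV[R]_d -> R) :
  measurable_fun [set: T] (g : T -> R) -> lint g = \int[lamV]_x (g x)%:E.
Proof.
move=> mg; rewrite integral_max0B /lint; congr (_ - _).
  apply: nnint_integral; first by move=> x; rewrite lee_fin le_max lexx orbT.
  exact: measurable_max0.
apply: nnint_integral; first by move=> x; rewrite lee_fin le_max lexx orbT.
by apply: measurable_max0; exact: measurable_funN.
Qed.

End LebesgueIntegral.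

(** * Union bound and outer measure on the sample space *)

Section OuterMeasureFiniteUnion.
Variables (R : realType) (T : Type) (mu : {outer_measure set T -> \bar R}).
Local Open Scope ereal_scope.

Lemma outer_measure_exists_le (I : finType) (P : pred I) (F : I -> set T) :
  mu [set x | exists i, P i /\ F i x] <= \sum_(i | P i) mu (F i).
Proof.
rewrite -big_filter; set s := [seq _ <- _ | _].
suff : mu [set x | exists2 i, i \in s & F i x] <= \sum_(i <- s) mu (F i).
  apply: le_trans; apply: le_outer_measure => x [i [Pi Fi]]; exists i => //.
  by rewrite mem_filter Pi mem_index_enum.
elim: s => [|i s IH].
  rewrite big_nil (_ : [set x | _] = set0) ?outer_measure0//.
  by apply/seteqP; split=> // x [].
rewrite big_cons; apply: le_trans (leeD2l (mu (F i)) IH).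
apply: le_trans (outer_measureU2 mu _ _); apply: le_outer_measure => x [j].
by rewrite inE => /orP[/eqP -> ?|js Fj]; [left|right; exists j].
Qed.

End OuterMeasureFiniteUnion.

Section SampleMeasure.
Variables (R : realType) (d n : nat).
Implicit Types (A : 'I_n -> set 'rV[R]_d) (v : 'I_n -> R).
Local Open Scope ereal_scope.

Definition sample_prod A : set ('I_n -> 'rV[R]_d) := [set X | forall j, A j (X j)].

Lemma lebS0 : lebS (set0 : set ('I_n -> 'rV[R]_d)) = 0.
Proof. by rewrite /lebS image_set0 leb_outer0. Qed.

Lemma lebS_ge0 (A : set ('I_n -> 'rV[R]_d)) : 0 <= lebS A.
Proof. exact: leb_outer_ge0. Qed.

Lemma le_lebS : {homo @lebS R n d : A B / A `<=` B >-> A <= B}.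
Proof. by move=> A B AB; apply: le_leb_outer; exact: image_subset. Qed.

Lemma lebS_sigma_subadditive : sigma_subadditive (@lebS R n d).
Proof. by move=> F; rewrite /lebS image_bigcup; exact: leb_outer_sigma_subadditive. Qed.

HB.instance Definition _ := isOuterMeasure.Build R ('I_n -> 'rV[R]_d) (@lebS R n d)
  lebS0 lebS_ge0 le_lebS lebS_sigma_subadditive.

Lemma lebV_cover_eps (A : set 'rV[R]_d) (v e : R) : lebV A <= v%:E -> (0 < e)%R ->
  exists u a b, vbox_cover A u a b /\
    \sum_(0 <= k <oo) weight (u k) (a k) (b k) <= (v + e)%:E.
Proof.
move=> Av e0; have fA : lebV A \is a fin_num.
  by rewrite ge0_fin_numE ?lebV_ge0//; apply: le_lt_trans Av _; rewrite ltry.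
have [u [a [b [[ab cv] hs]]]] := leb_outer_cover_eps fA e0.
exists u, a, b; split.
  split=> // x Ax; have [|k uk xk] := cv (coordV x); first by exists x.
  by exists k.
by apply: le_trans hs _; rewrite EFinD leeD2r.
Qed.

Lemma prod_if_neq (v : 'I_n -> R) (j0 : 'I_n) (c : R) :
  (\prod_j (if j == j0 then c else v j) = c * \prod_(j | j != j0) v j)%R.
Proof.
rewrite (bigD1 j0)//= eqxx; congr *%R.
by apply: eq_bigr => j /negbTE ->.
Qed.

(* Boxes are exchanged for arbitrary sets one coordinate at a time, so that only
   countable covers of a single factor are ever needed. *)
Lemma lebS_prod_le A v : (forall j, lebV (A j) <= (v j)%:E) ->
  lebS (sample_prod A) <= (\prod_j v j)%:E.
Proof.
move=> Av.
suff H m : (m <= n)%N -> forall A v,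
    (forall j : 'I_n, (j < m)%N -> lebV (A j) <= (v j)%:E) ->
    (forall j : 'I_n, (m <= j)%N -> exists a b, [/\ forall i, (a i <= b i)%R,
       A j = vbox a b & v j = boxvol a b]) ->
    lebS (sample_prod A) <= (\prod_j v j)%:E.
  by apply: (H n) => // j; rewrite leqNgt ltn_ord.
elim: m => [_|m IH mn] {Av}{}A {}v Av Bv.
  have [ab Hab] := choice (fun j => Bv j isT).
  have [b Hb] := choice (fun j => Hab j).
  pose a' p := ab p.1 p.2; pose b' p := b p.1 p.2.
  apply: le_trans (_ : leb_outer (box a' b') <= _).
    apply: le_leb_outer => _ [X XA <-] [j i]; rewrite /a' /b' /coordS /=.
    by have := XA j; case: (Hb j) => _ -> _; exact.
  apply: le_trans (leb_outer_box _) _.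
    by move=> [j i]; rewrite /a' /b' /=; case: (Hb j).
  rewrite lee_fin /boxvol -(pair_bigA _ (fun j i => (b j i - ab j i)%R)) /=.
  rewrite le_eqVlt; apply/orP; left; apply/eqP; apply: eq_bigr => j _.
  by case: (Hb j) => _ _ ->.
pose j0 := Ordinal mn.
have v0 j : (0 <= v j)%R.
  case: (ltnP j m.+1) => jm; first by rewrite -lee_fin (le_trans _ (Av _ jm)) ?lebV_ge0.
  by have [a [b [ab _ ->]]] := Bv _ jm; exact: boxvol_ge0.
pose C := (\prod_(j | j != j0) v j)%R.
have C0 : (0 <= C)%R by apply: prodr_ge0.
have -> : (\prod_j v j = C * v j0)%R by rewrite (bigD1 j0)//= mulrC.
apply/lee_addgt0Pr => e e0.
(* [C] may vanish, hence the denominator [C + 1]. *)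
have e1 : (0 < e / (C + 1))%R by rewrite divr_gt0// ltr_wpDl.
have [u [a [b [[ab cv] hs]]]] := lebV_cover_eps (Av j0 (ltnSn m)) e1.
pose Ak k j := if j == j0 then (if u k then vbox (a k) (b k) else set0) else A j.
have lek k : lebS (sample_prod (Ak k)) <= C%:E * weight (u k) (a k) (b k).
  rewrite /weight; case uk: (u k); last first.
    rewrite mule0 (_ : sample_prod _ = set0) ?lebS0//.
    by apply/seteqP; split=> // X /(_ j0); rewrite /Ak eqxx uk.
  rewrite -EFinM mulrC -prod_if_neq; apply: IH; first exact: ltnW.
    move=> j jm; have jj0 : j == j0 = false.
      by apply/eqP => jj0; move: jm; rewrite jj0 ltnn.
    by rewrite /Ak jj0; apply: Av; rewrite ltnS ltnW.
  move=> j; rewrite leq_eqVlt => /orP[/eqP mj|mj].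
    have -> : j = j0 by apply/val_inj.
    by exists (a k), (b k); rewrite /Ak eqxx uk.
  have [a' [b' [ab' E1 E2]]] := Bv _ mj; exists a', b'.
  have jj0 : j == j0 = false by apply/eqP => jj0; move: mj; rewrite jj0 ltnn.
  by rewrite /Ak jj0.
apply: le_trans (_ : \sum_(0 <= k <oo) lebS (sample_prod (Ak k)) <= _).
  apply: le_trans (lebS_sigma_subadditive _); apply: le_lebS => X XA.
  have [k uk xk] := cv _ (XA j0); exists k => // j; rewrite /Ak.
  by case: eqP => [->|_]; [rewrite uk|exact: XA].
apply: le_trans (_ : \sum_(0 <= k <oo) C%:E * weight (u k) (a k) (b k) <= _).
  by apply: lee_nneseries => k *; [exact: lebS_ge0|exact: lek].
rewrite nneseriesZl; last by move=> k _; exact: weight_ge0.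
apply: le_trans (lee_wpmul2l _ hs) _; first by rewrite lee_fin.
rewrite -EFinM -EFinD lee_fin mulrDr lerD2l mulrCA ger_pMr// ler_pdivrMr ?ltr_wpDl//.
by rewrite mul1r lerDl.
Qed.

(* Integrating out one coordinate at a time turns [sum_k prod_j 1_{B_k^j} >= 1] on
   [Om^n] into [sum_k prod_j vol(B_k^j) >= lebV(Om)^n]. *)
Lemma lebS_pow_ge (Om : set 'rV[R]_d) (L : R) : (0 <= L)%R -> L%:E <= lebV Om ->
  (L ^+ n)%:E <= lebS [set X : 'I_n -> 'rV[R]_d | forall j, Om (X j)].
Proof.
move=> L0 LOm; apply: leb_outer_glb => u a b [ab cv].
pose aj k (j : 'I_n) (i : 'I_d) := a k (j, i); pose bj k (j : 'I_n) (i : 'I_d) := b k (j, i).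
pose B k j : set 'rV[R]_d := vbox (aj k j) (bj k j).
pose vol k j := boxvol (aj k j) (bj k j).
have vol0 k j : (0 <= vol k j)%R by apply: boxvol_ge0 => i; exact: ab.
pose F m (X : 'I_n -> 'rV[R]_d) k : R := if u k then
  (\prod_(j < n) (if (j < m)%N then vol k j else \1_(B k j) (X j)))%R else 0%R.
have F0 m X k : (0 <= F m X k)%R.
  by rewrite /F; case: ifP => // _; apply: prodr_ge0 => j _; case: ifP.
suff H m : (m <= n)%N -> forall X, (forall j, Om (X j)) ->
    (L ^+ m)%:E <= \sum_(0 <= k <oo) (F m X k)%:E.
  (* If no sample lies in [Om], then [n > 0] and [Om] is empty, so that [L = 0]; for [n = 0] the
     empty sample qualifies. *)
  have [[X XOm]|nX] := pselect (exists X : 'I_n -> 'rV[R]_d, forall j, Om (X j)).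
    apply: le_trans (H n (leqnn n) X XOm) _; apply: lee_nneseries => k *.
      by rewrite lee_fin.
    rewrite lee_fin /F; case: (u k) => //.
    rewrite /boxvol (eq_bigr (fun p => bj k p.1 p.2 - aj k p.1 p.2)%R); last by case.
    rewrite -(pair_bigA _ (fun j i => (bj k j i - aj k j i)%R)) /=.
    by apply: ler_prod => j _; rewrite ltn_ord vol0 /=.
  have Om0 : Om = set0.
    apply/seteqP; split=> // x Omx; apply: nX.
    by exists (fun=> x).
  have n0 : (0 < n)%N.
    rewrite lt0n; apply/eqP => n0; apply: nX; exists (fun=> 0%R) => j.
    by have := ltn_ord j; rewrite [X in (_ <= X)%N]n0.
  have -> : L = 0%R.
    by apply/eqP; rewrite eq_le L0 andbT -lee_fin; move: LOm; rewrite Om0 lebV0.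
  rewrite expr0n gtn_eqF//=.
  by apply: nneseries_ge0 => k *; exact: weight_ge0.
elim: m => [_ X XOm|m IH mn X XOm].
  have [|k uk xk] := cv (coordS X); first by exists X.
  rewrite expr0; apply: le_trans (_ : (F 0%N X k)%:E <= _).
    rewrite /F uk big1// => j _; rewrite indicE mem_set// => i.
    exact: (xk (j, i)).
  rewrite (nneseries_split 0 k.+1); last by move=> *; rewrite lee_fin.
  rewrite big_nat_recr//= -[leLHS]add0e -[X in X <= _]adde0.
  apply: leeD; last by apply: nneseries_ge0 => *; rewrite lee_fin.
  by apply: leeD => //; apply: sume_ge0 => *; rewrite lee_fin.
pose j0 := Ordinal mn.
pose G k : R := if u k then
  (\prod_(j < n | j != j0) (if (j < m)%N then vol k j else \1_(B k j) (X j)))%R else 0%R.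
have G0 k : (0 <= G k)%R.
  by rewrite /G; case: ifP => // _; apply: prodr_ge0 => j _; case: ifP.
pose h (x : 'rV[R]_d) := \sum_(0 <= k <oo) (G k * \1_(B k j0) x)%:E.
(* The induction hypothesis for the sample whose coordinate [j0] is moved to [x]; Markov's
   inequality then integrates this coordinate out. *)
have hOm x : Om x -> (L ^+ m)%:E <= h x.
  move=> Omx; pose X' j := if j == j0 then x else X j.
  have /IH : forall j, Om (X' j) by move=> j; rewrite /X'; case: eqP.
  move=> /(_ (ltnW mn)) /le_trans; apply.
  apply: lee_nneseries => k *; first by rewrite lee_fin.
  rewrite lee_fin /F /G; case: (u k); last by rewrite mul0r.
  rewrite (bigD1 j0)//= ltnn /X' eqxx mulrC ler_wpM2r//.
  by rewrite le_eqVlt; apply/orP; left; apply/eqP; apply: eq_bigr => j /negbTE ->.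
have mB k : measurable (B k j0 : set (caratheodory_type (@lebV R d))).
  exact: measurable_vbox.
have [mh inth] := integral_indic_series (lamV R d) G0 mB.
have h0 x : 0 <= h x by apply: nneseries_ge0 => *; rewrite lee_fin mulr_ge0.
have [E [mE OmE LE]] := @markov_outer _ _ _ (lamV R d) h _ Om (exprn_ge0 m L0) h0 mh hOm.
rewrite exprSr EFinM.
apply: le_trans (_ : (L ^+ m)%:E * lebV E <= _).
  apply: lee_wpmul2l; first by rewrite lee_fin exprn_ge0.
  by apply: le_trans LOm _; exact: le_lebV.
apply: le_trans LE _; rewrite inth; apply: lee_nneseries => k *.
  by rewrite mule_ge0 ?lee_fin// measure_ge0.
apply: le_trans (lee_wpmul2l _ (lebV_box _)) _.
- by rewrite lee_fin.
- by move=> i; exact: ab.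
rewrite -EFinM lee_fin /G /F; case: (u k); last by rewrite mul0r.
rewrite [leRHS](bigD1 j0)//= ltnSn mulrC ler_wpM2l//; first exact: vol0.
rewrite le_eqVlt; apply/orP; left; apply/eqP; apply: eq_bigr => j jj0.
suff jm : (j != m :> nat) by rewrite ltnS [in LHS]ltn_neqAle jm.
by apply: contra jj0 => /eqP jm; apply/eqP/val_inj.
Qed.

End SampleMeasure.

(** * Chernoff bound for the number of sample points in a set *)

Section Chernoff.
Variables (R : realType) (d n : nat).
Local Open Scope ereal_scope.

Definition hits (Q : set 'rV[R]_d) (X : 'I_n -> 'rV[R]_d) : {set 'I_n} :=
  finset (fun j => `[< Q (X j) >]).

(** The event is split according to the set [S] of indices that hit [Q], so that each piece is
    contained in a product set. As [#|S| < n q / 4], the factor [exp (n q / 4 - #|S|)] is at least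
    1. Once it is inserted, the sum over all [S] is [exp (n q / 4) L^n] times the expansion of
    [(q / e + 1 - q)^n], and [1 / e <= 1 / 2] bounds that base by [exp (- q / 2)]. *)
Lemma few_hits_le (Om Q : set 'rV[R]_d) (L q : R) : (0 <= L)%R -> (0 <= q)%R ->
  Q `<=` Om -> leb_measurable_set Q ->
  lebV Om = L%:E -> lebV Q = (q * L)%:E ->
  lebS [set X : 'I_n -> 'rV[R]_d |
    (forall j, Om (X j)) /\ (#|hits Q X|%:R < n%:R * q / 4)%R] <=
  (expR (- (n%:R * q / 4)) * L ^+ n)%:E.
Proof.
move=> L0 q0 QOm mQ LOm LQ.
have LD : lebV (Om `&` ~` Q) = ((1 - q) * L)%:E.
  have := mQ Om; rewrite LOm (_ : Om `&` Q = Q); last by apply/setIidPr.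
  have fD : lebV (Om `&` ~` Q) \is a fin_num.
    rewrite ge0_fin_numE ?lebV_ge0//; apply: le_lt_trans (ltry L).
    by rewrite -LOm; apply: le_lebV => x [].
  rewrite LQ -(fineK fD) => -[] /eqP; rewrite addrC -subr_eq => /eqP <-.
  by congr EFin; ring.
pose P := [pred S : {set 'I_n} | (#|S|%:R < n%:R * q / 4)%R].
pose B (S : {set 'I_n}) : 'I_n -> set 'rV[R]_d :=
  fun j => if j \in S then Q else Om `&` ~` Q.
apply: le_trans (_ : lebS [set X | exists S, P S /\ sample_prod (B S) X] <= _).
  apply: le_lebS => X [XOm fX]; exists (hits Q X); split=> // j.
  by rewrite /B finset.in_set; case: asboolP => // nQ; split.
apply: le_trans (outer_measure_exists_le (@lebS R n d) P _) _.
pose x := (q * L * expR (-1))%R; pose y := ((1 - q) * L)%R.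
have y0 : (0 <= y)%R by rewrite -lee_fin -LD lebV_ge0.
have x0 : (0 <= x)%R by rewrite !mulr_ge0// expR_ge0.
apply: le_trans (_ : \sum_(S : {set 'I_n})
   (expR (n%:R * q / 4) * \prod_(j < n) (if j \in S then x else y))%:E <= _).
  rewrite big_mkcond /=; apply: lee_sum => S _; case: ifPn => PS; last first.
    by rewrite lee_fin mulr_ge0 ?expR_ge0// prodr_ge0// => j _; case: ifP.
  pose v (j : 'I_n) := (if j \in S then q * L else y)%R.
  apply: le_trans (@lebS_prod_le _ _ _ _ v _) _.
    by move=> j; rewrite /B /v; case: ifP => _; rewrite ?LQ// LD.
  rewrite lee_fin.
  have <- : (expR (-1) ^+ #|S| * \prod_j v j =
      \prod_(j < n) (if j \in S then x else y))%R.
    rewrite -prodr_const big_mkcond -big_split /=.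
    apply: eq_bigr => j _; rewrite /v /x; case: ifP => _; last by rewrite mul1r.
    exact: mulrC.
  rewrite mulrA ler_peMl//.
    apply: prodr_ge0 => j _; rewrite /v; case: ifP => // _; exact: mulr_ge0.
  rewrite -expRM_natl -expRD -[leLHS]expR0 ler_expR mulrN1 subr_ge0.
  exact: ltW.
rewrite sumEFin lee_fin -big_distrr /=.
rewrite -(bigA_distr _ (@GRing.add R) (fun=> x) (fun=> y)) /= prodr_const card_ord.
have xy : (x + y <= L * expR (- (q / 2)))%R.
  have e2 : (expR (-1) <= 2^-1 :> R)%R.
    rewrite expRN lef_pV2 ?posrE ?expR_gt0//.
    by have := @expR_ge1Dx R 1; rewrite (_ : 1 + 1 = 2)%R.
  have h1 : (x + y <= L * (1 - q / 2))%R.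
    rewrite /x /y; have := ler_wpM2l (mulr_ge0 q0 L0) e2; lra.
  by apply: le_trans h1 _; apply: ler_wpM2l => //; exact: expR_ge1Dx.
apply: le_trans (_ : expR (n%:R * q / 4) * (L * expR (- (q / 2))) ^+ n <= _)%R.
  by rewrite ler_wpM2l ?expR_ge0// lerXn2r ?nnegrE ?addr_ge0// mulr_ge0 ?expR_ge0.
rewrite exprMn mulrCA mulrC ler_wpM2r ?exprn_ge0// -expRM_natl -expRD ler_expR.
by rewrite le_eqVlt; apply/orP; left; apply/eqP; field.
Qed.

End Chernoff.

(** * Kernel sections and kernel ridge regression in the native space *)

Section RKHSLemmas.
Variables (R : realType) (d : nat) (Om : set 'rV[R]_d) (Psi : 'rV[R]_d -> R).
Variables (H : set ('rV[R]_d -> R)).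
Variable (ip : ('rV[R]_d -> R) -> ('rV[R]_d -> R) -> R).
Hypothesis HR : is_RKHS Om Psi H ip.

Definition kern (x : 'rV[R]_d) := restr0 Om (fun y => Psi (y - x)).

Lemma restr0_in (g : 'rV[R]_d -> R) x : Om x -> restr0 Om g x = g x.
Proof. by move=> Omx; rewrite /restr0 patchT// inE. Qed.

Lemma ip0l k : H k -> ip (fun=> 0) k = 0.
Proof.
move=> Hk; have := rkhs_ip_lin HR (-1) (rkhs_zero HR) (rkhs_zero HR) Hk.
rewrite (_ : (fun y => _) = (fun=> 0)); last by apply/funext => y; rewrite mulr0 addr0.
by move=> ->; rewrite mulN1r addNr.
Qed.

Lemma ip_ge0 g : H g -> 0 <= ip g g.
Proof.
move=> Hg; have [->|/eqP g0] := eqVneq g (fun=> 0).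
  by rewrite ip0l//; exact: rkhs_zero HR.
by apply/ltW; exact: (rkhs_ip_pos HR).
Qed.

Lemma ip_sum (I : finType) (a : I -> R) (g : I -> 'rV[R]_d -> R) :
  (forall i, H (g i)) ->
  H (fun y => \sum_i a i * g i y) /\
  forall k, H k -> ip (fun y => \sum_i a i * g i y) k = \sum_i a i * ip (g i) k.
Proof.
move=> Hg; elim: (index_enum I) => [|i s [H1 H2]].
  have -> : (fun y => \sum_(i <- [::]) a i * g i y) = (fun=> 0).
    by apply/funext => y; rewrite big_nil.
  split; first exact: (rkhs_zero HR).
  by move=> k Hk; rewrite big_nil ip0l.
have -> : (fun y => \sum_(j <- i :: s) a j * g j y) =
    (fun y => a i * g i y + \sum_(j <- s) a j * g j y).
  by apply/funext => y; rewrite big_cons.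
split; first exact: (rkhs_lin HR).
by move=> k Hk; rewrite (rkhs_ip_lin HR)// H2// big_cons.
Qed.

Lemma ip_linD t g h : H g -> H h ->
  ip (fun y => t * h y + g y) (fun y => t * h y + g y) =
  t ^+ 2 * ip h h + 2 * t * ip g h + ip g g.
Proof.
move=> Hg Hh; have Hs := rkhs_lin HR t Hh Hg.
rewrite (rkhs_ip_lin HR)// (rkhs_ip_sym HR Hh Hs) (rkhs_ip_sym HR Hg Hs).
rewrite !(rkhs_ip_lin HR)// (rkhs_ip_sym HR Hh Hg); ring.
Qed.

Lemma ip_cauchy_schwarz g h : H g -> H h -> ip g h ^+ 2 <= ip g g * ip h h.
Proof.
move=> Hg Hh; have [h0|/eqP h0] := eqVneq h (fun=> 0).
  have gh0 : ip g h = 0 by rewrite (rkhs_ip_sym HR)// h0 ip0l.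
  by rewrite gh0 expr0n /= mulr_ge0// ip_ge0.
have hp := rkhs_ip_pos HR Hh h0.
have := ip_ge0 (rkhs_lin HR (- (ip g h / ip h h)) Hh Hg).
rewrite ip_linD//.
have -> : (- (ip g h / ip h h)) ^+ 2 * ip h h + 2 * - (ip g h / ip h h) * ip g h + ip g g
  = (ip g g * ip h h - ip g h ^+ 2) / ip h h by field; rewrite gt_eqF.
by rewrite pmulr_lge0 ?invr_gt0// subr_ge0.
Qed.

Lemma ip_kern g x : Om x -> H g -> ip (kern x) g = g x.
Proof.
move=> Omx Hg; rewrite (rkhs_ip_sym HR)//; last exact: rkhs_kernel HR _ Omx.
exact: (rkhs_reprod HR).
Qed.

Section KernelCombination.
Variables (I : finType) (p : I -> 'rV[R]_d) (a : I -> R).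
Hypothesis pOm : forall i, Om (p i).

Definition kcomb y := \sum_i a i * kern (p i) y.

Lemma H_kcomb : H kcomb.
Proof. by apply: (ip_sum _ _).1 => i; exact: (rkhs_kernel HR). Qed.

Lemma ip_kcomb g : H g -> ip kcomb g = \sum_i a i * g (p i).
Proof.
move=> Hg; rewrite /kcomb (ip_sum _ _).2//; last by move=> i; exact: (rkhs_kernel HR).
by apply: eq_bigr => i _; rewrite ip_kern.
Qed.

Lemma kcombE x : Om x -> kcomb x = \sum_i a i * Psi (x - p i).
Proof. by move=> Omx; apply: eq_bigr => i _; rewrite /kern restr0_in. Qed.

Lemma ip_kcomb_kcomb : ip kcomb kcomb = \sum_j \sum_k a j * a k * Psi (p j - p k).
Proof.
rewrite ip_kcomb; last exact: H_kcomb.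
apply: eq_bigr => j _; rewrite kcombE// big_distrr /=.
by apply: eq_bigr => k _; rewrite mulrA.
Qed.

(** Cauchy-Schwarz for the Riesz representer [kcomb] of the functional, whose squared norm is the
    kernel quadratic form. *)
Lemma functional_le g : H g ->
  (\sum_i a i * g (p i)) ^+ 2 <=
  ip g g * \sum_j \sum_k a j * a k * Psi (p j - p k).
Proof.
move=> Hg; rewrite -ip_kcomb// -ip_kcomb_kcomb mulrC.
exact: ip_cauchy_schwarz H_kcomb Hg.
Qed.

End KernelCombination.

Section KernelRidge.
Variables (n : nat) (X : 'I_n -> 'rV[R]_d) (f : 'rV[R]_d -> R) (mu : R).
Hypotheses (XOm : forall j, Om (X j)) (mu0 : 0 < mu) (Hf : H (restr0 Om f)).
Let g := restr0 Om f.
Let A : 'M[R]_n := \matrix_(j, k) Psi (X j - X k) + mu%:M.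

(** [v A v^T] is the squared norm of a kernel combination plus [mu |v|^2]. Taking the positivity of
    the Gram part from [ip] accommodates repeated sample points. *)
Lemma krr_matrix_unit : A \in unitmx.
Proof.
rewrite -row_free_unit; apply: inj_row_free => v vA0.
have : (v *m A *m v^T) ord0 ord0 = 0 by rewrite vA0 mul0mx mxE.
rewrite /A mulmxDr mulmxDl mul_mx_scalar -scalemxAl [LHS]mxE.
set q := (X in X + _); have q0 : 0 <= q.
  have -> : q = ip (kcomb X (fun k => v ord0 k)) (kcomb X (fun k => v ord0 k)).
    rewrite ip_kcomb_kcomb// /q mxE exchange_big /=; apply: eq_bigr => k _.
    rewrite !mxE big_distrl /=; apply: eq_bigr => j _; rewrite !mxE; ring.
  by apply: ip_ge0; exact: H_kcomb.
rewrite mxE [X in _ + _ * X]mxE.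
have -> : \sum_j v ord0 j * v^T j ord0 = \sum_j v ord0 j ^+ 2.
  by apply: eq_bigr => j _; rewrite mxE expr2.
have s0 : 0 <= \sum_j v ord0 j ^+ 2 by apply: sumr_ge0 => j _; exact: sqr_ge0.
move=> /eqP; rewrite paddr_eq0// ?(mulr_ge0 (ltW mu0) s0)// => /andP[_].
rewrite mulf_eq0 gt_eqF//= psumr_eq0; last by move=> j _; exact: sqr_ge0.
move=> /allP v0; apply/rowP => j; rewrite mxE.
by have := v0 j (mem_index_enum _); rewrite /= sqrf_eq0 => /eqP.
Qed.

Let c : 'cV[R]_n := invmx A *m \col_(k < n) f (X k).

(** Built from functions cut off outside [Om], as membership in [H] demands; on [Om] it is the
    estimation error. *)
Definition krr_err y := g y - kcomb X (fun k => c k ord0) y.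

Lemma krr_errE x : Om x -> krr_err x = f x - krr_estimator Psi mu f X x.
Proof.
move=> Omx; rewrite /krr_err /g restr0_in// kcombE//; congr (_ - _).
rewrite /krr_estimator -mulmxA -/c mxE; apply: eq_bigr => k _.
by rewrite [X in _ = X * _]mxE mulrC.
Qed.

Let krr_coefE j : \sum_k c k ord0 * Psi (X j - X k) + mu * c j ord0 = f (X j).
Proof.
have : (A *m c) j ord0 = f (X j) by rewrite /c mulKVmx ?krr_matrix_unit// mxE.
rewrite /A mulmxDl mul_scalar_mx !mxE => <-; congr (_ + _).
by apply: eq_bigr => k _; rewrite [X in _ = X * _]mxE mulrC.
Qed.

Lemma krr_err_node j : krr_err (X j) = mu * c j ord0.
Proof.
by rewrite /krr_err /g restr0_in// kcombE// -krr_coefE addrAC subrr add0r.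
Qed.

Lemma H_krr_err : H krr_err.
Proof.
have -> : krr_err = (fun y => (-1) * kcomb X (fun k => c k ord0) y + g y).
  by apply/funext => y; rewrite /krr_err mulN1r addrC.
by apply: (rkhs_lin HR) => //; exact: H_kcomb.
Qed.

(** Let [s] be the fitted kernel combination. By the reproducing property and the normal equations
    [ip s g = ip s s + mu |c|^2]; expanding [ip (g - s) (g - s)] gives the identity. Both error
    bounds are read off from it, the residual at node [j] being [mu c_j]. *)
Let krr_energy : ip krr_err krr_err + ip (kcomb X (fun k => c k ord0)) (kcomb X (fun k => c k ord0))
  + 2 * mu * \sum_k c k ord0 ^+ 2 = ip g g.
Proof.
set s := kcomb _ _; have Hs : H s by exact: H_kcomb.
have -> : krr_err = (fun y => (-1) * s y + g y).
  by apply/funext => y; rewrite /krr_err mulN1r addrC.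
rewrite ip_linD// [ip g s](rkhs_ip_sym HR)//.
have -> : ip s g = ip s s + mu * \sum_k c k ord0 ^+ 2; last by ring.
rewrite !ip_kcomb// big_distrr -big_split /=; apply: eq_bigr => k _.
by rewrite /g restr0_in// -krr_coefE /s kcombE//; ring.
Qed.

Lemma krr_err_norm : ip krr_err krr_err <= ip g g.
Proof.
rewrite -krr_energy -addrA lerDl addr_ge0//.
  by apply: ip_ge0; exact: H_kcomb.
apply: mulr_ge0; first by rewrite mulr_ge0// ltW.
by apply: sumr_ge0 => k _; exact: sqr_ge0.
Qed.

Lemma krr_err_empirical : \sum_k krr_err (X k) ^+ 2 <= mu * ip g g.
Proof.
rewrite -krr_energy.
under eq_bigr do rewrite krr_err_node exprMn.
rewrite -mulr_sumr (expr2 mu) -(mulrA mu mu) ler_pM2l//.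
have s0 : 0 <= mu * \sum_k c k ord0 ^+ 2.
  apply: mulr_ge0 (ltW mu0) _; by apply: sumr_ge0 => k _; exact: sqr_ge0.
have e0 := ip_ge0 H_krr_err.
have k0 : 0 <= ip (kcomb X (fun k => c k ord0)) (kcomb X (fun k => c k ord0)).
  by apply: ip_ge0; exact: H_kcomb.
by lra.
Qed.

End KernelRidge.
End RKHSLemmas.

(** * Spectral representation and bound of kernel quadratic forms *)

Section LinearCombinationIntegral.
Context (disp : measure_display) (T : measurableType disp) (R : realType).
Variable mu : {measure set T -> \bar R}.
Local Open Scope ereal_scope.

Lemma integral_lincomb (I : finType) (c : I -> R) (g : I -> T -> R) :
  (forall i, mu.-integrable [set: T] (EFin \o g i)) ->
  \int[mu]_x (\sum_i c i * g i x)%:E = \sum_i (c i)%:E * \int[mu]_x (g i x)%:E.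
Proof.
move=> ig; under eq_integral do rewrite -sumEFin.
rewrite integral_sum//; last first.
  move=> i; rewrite (_ : (fun x => _) = (fun x => (c i)%:E * (EFin \o g i) x)).
    exact: integrableZl.
  by apply/funext => x; rewrite /= EFinM.
apply: eq_bigr => i _; under eq_integral do rewrite EFinM.
exact: (integralZl measurableT (ig i)).
Qed.

Lemma integrable_cosM (f t : T -> R) : mu.-integrable [set: T] (EFin \o f) ->
  measurable_fun [set: T] t ->
  mu.-integrable [set: T] (EFin \o (fun x => cos (t x) * f x)%R).
Proof.
move=> If mt; apply: (le_integrable measurableT _ _ If).
  apply/measurable_EFinP/measurable_funM; last first.
    by apply/measurable_EFinP; exact: measurable_int If.
  have mcos : measurable_fun [set: R] (@cos R).
    exact: continuous_measurable_fun (@continuous_cos R).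
  exact: (measurableT_comp mcos mt).
by move=> x _ /=; rewrite lee_fin normrM ler_piMl// cos_max.
Qed.

End LinearCombinationIntegral.

Section SpectralBound.
Variables (R : realType) (d : nat) (Psi fPsi : 'rV[R]_d -> R) (c1 c2 nu : R).
Hypotheses (Psi1 : Psi 0 = 1) (sd : spectral_density Psi fPsi).
Hypotheses (c1_gt0 : 0 < c1) (nu_gt0 : 0 < nu).
Hypothesis fPsi_bnd : forall w, c1 * (1 + sqnorm2 w) `^ (- nu) <= fPsi w
  <= c2 * (1 + sqnorm2 w) `^ (- nu).
Local Notation T := (caratheodory_type (@lebV R d)).

Lemma sqnorm2_ge0 (w : 'rV[R]_d) : 0 <= sqnorm2 w.
Proof. by apply: sumr_ge0 => i _; exact: sqr_ge0. Qed.

Lemma sqnorm2Z t (w : 'rV[R]_d) : sqnorm2 (t *: w) = t ^+ 2 * sqnorm2 w.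
Proof. by rewrite /sqnorm2 mulr_sumr; apply: eq_bigr => i _; rewrite mxE exprMn. Qed.

Lemma dotVZ t (w h : 'rV[R]_d) : dotV w (t *: h) = dotV (t *: w) h.
Proof. by apply: eq_bigr => i _; rewrite !mxE; ring. Qed.

Lemma dotVB (w h k : 'rV[R]_d) : dotV w (h - k) = dotV w h - dotV w k.
Proof. by rewrite /dotV -sumrB; apply: eq_bigr => i _; rewrite !mxE; ring. Qed.

Let fPsi_ge0 w : 0 <= fPsi w.
Proof.
have /andP[+ _] := fPsi_bnd w; apply: le_trans.
by rewrite mulr_ge0 ?powR_ge0// ltW.
Qed.

Let mfPsi : measurable_fun [set: T] (fPsi : T -> R).
Proof. exact: leb_measurable_funP sd.1. Qed.

(** The spectral formula at the origin: [Psi 0 = 1] is the total mass of [fPsi]. This gives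
    integrability and, later, the value of the dilated integral. *)
Let int_fPsi : (\int[lamV R d]_x (fPsi x)%:E = 1)%E.
Proof.
rewrite -(lint_integral mfPsi) -Psi1 -(sd.2 0).1; congr lint; apply/funext => w.
rewrite (_ : dotV w 0 = 0) ?cos0 ?mul1r//.
by apply: big1 => i _; rewrite mxE mulr0.
Qed.

Let integrable_fPsi : (lamV R d).-integrable [set: T] (EFin \o (fPsi : T -> R)).
Proof.
apply/integrableP; split; first exact/measurable_EFinP.
under eq_integral do rewrite /= ger0_norm//.
by rewrite int_fPsi ltry.
Qed.

Let Psi_integral h :
  (\int[lamV R d]_w (cos (dotV w h) * fPsi w)%:E = (Psi h)%:E)%E.
Proof.
rewrite -(sd.2 h).1; apply/esym/lint_integral/measurable_EFinP.
apply: measurable_int; apply: integrable_cosM; first exact: integrable_fPsi.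
exact: measurable_dotV.
Qed.

Section QuadraticForm.
Variables (I : finType) (a : I -> R) (p : I -> 'rV[R]_d).

(** Squared modulus of [sum_i a_i exp (i w.p_i)], in real form. *)
Definition symbol (w : 'rV[R]_d) : R :=
  (\sum_i a i * cos (dotV w (p i))) ^+ 2 + (\sum_i a i * sin (dotV w (p i))) ^+ 2.

Lemma symbol_ge0 w : 0 <= symbol w.
Proof. by rewrite addr_ge0 ?sqr_ge0. Qed.

Let quad_symbol (w : 'rV[R]_d) :
  \sum_(q : I * I) (a q.1 * a q.2) * (cos (dotV w (p q.1 - p q.2)) * fPsi w) =
  symbol w * fPsi w.
Proof.
rewrite -(pair_bigA _ (fun j k => (a j * a k) * (cos (dotV w (p j - p k)) * fPsi w))) /=.
rewrite /symbol !expr2 !mulr_suml -big_split mulr_suml /=; apply: eq_bigr => j _.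
rewrite !mulr_sumr -big_split mulr_suml /=; apply: eq_bigr => k _.
by rewrite dotVB cosB; ring.
Qed.

Lemma quad_form_integral :
  ((\sum_j \sum_k a j * a k * Psi (p j - p k))%:E =
   \int[lamV R d]_w (symbol w * fPsi w)%:E)%E /\
  measurable_fun [set: T] (fun w : T => (symbol w * fPsi w)%:E).
Proof.
have ic (q : I * I) : (lamV R d).-integrable [set: T]
    (EFin \o (fun w : T => cos (dotV w (p q.1 - p q.2)) * fPsi w)).
  by apply: integrable_cosM; [exact: integrable_fPsi|exact: measurable_dotV].
split.
  transitivity (\int[lamV R d]_w (\sum_(q : I * I) (a q.1 * a q.2) *
     (cos (dotV w (p q.1 - p q.2)) * fPsi w))%:E)%E; last first.
    by apply: eq_integral => w _; rewrite quad_symbol.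
  rewrite (integral_lincomb _ ic).
  rewrite -sumEFin.
  rewrite -(pair_bigA _ (fun j k => (a j * a k)%:E *
    \int[lamV R d]_w (cos (dotV w (p j - p k)) * fPsi w)%:E)%E) /=.
  apply: eq_bigr => j _; rewrite -sumEFin; apply: eq_bigr => k _.
  by rewrite Psi_integral EFinM.
rewrite (_ : (fun w => _) = (fun w : T => (\sum_(q : I * I) (a q.1 * a q.2) *
     (cos (dotV w (p q.1 - p q.2)) * fPsi w))%:E)); last first.
  by apply/funext => w; rewrite quad_symbol.
apply/measurable_EFinP; apply: measurable_sum => q.
apply: measurable_funM; first exact: measurable_cst.
by apply/measurable_EFinP; exact: measurable_int (ic q).
Qed.

End QuadraticForm.

Lemma le_nnint (h1 h2 : 'rV[R]_d -> \bar R) : (forall x, (h1 x <= h2 x)%E) ->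
  (nnint h1 <= nnint h2)%E.
Proof.
move=> h12; apply: le_ereal_sup => _ [k [c [E [c0 mE cE ->]]]].
exists k, c, E; split=> // x; exact: le_trans (cE x) (h12 x).
Qed.

(** With [t = rho^2 s] and denominators cleared, the claim is [min (1, t^m) (1 + t)^nu <= (2 rho^2
    (1 + s))^nu], where [t <= rho^2 (1 + s)]. If [t >= 1], then [1 + t <= 2 t]. If [t < 1], then
    [t^m <= t^nu] because [nu <= m], and [t (1 + t) <= 2 t]. *)
Lemma bessel_scale_le (s rho : R) (m : nat) : 0 <= s -> 0 < rho -> nu <= m%:R ->
  (1 + s) `^ (- nu) * Num.min 1 ((rho ^+ 2 * s) ^+ m) <=
  2 `^ nu * rho `^ (2 * nu) * (1 + rho ^+ 2 * s) `^ (- nu).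
Proof.
move=> s0 r0 num; have nu0 := ltW nu_gt0.
have s1 : 0 < 1 + s by rewrite ltr_pwDl.
set t := rho ^+ 2 * s; have t0 : 0 <= t by rewrite mulr_ge0// sqr_ge0.
have t1 : 0 < 1 + t by rewrite ltr_pwDl.
have -> : 2 `^ nu * rho `^ (2 * nu) = (2 * rho ^+ 2) `^ nu.
  by rewrite powRrM (powR_mulrn _ (ltW r0)) -powRM// sqr_ge0.
rewrite !powRN mulrC ler_pdivrMr ?powR_gt0// mulrAC ler_pdivlMr ?powR_gt0//.
rewrite -(powRM _ _ (ltW s1)); last by rewrite mulr_ge0// sqr_ge0.
have mono x y : 0 <= x -> x <= y -> x `^ nu <= y `^ nu.
  by move=> x0 xy; apply: ge0_ler_powR => //; rewrite nnegrE// (le_trans x0).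
have [t_ge1|t_lt1] := leP 1 t.
  apply: le_trans (_ : 1 * (1 + t) `^ nu <= _).
    by rewrite ler_wpM2r ?powR_ge0// ge_min lexx.
  rewrite mul1r; apply: mono; first exact: ltW.
  by move: t_ge1; rewrite /t; have := sqr_ge0 rho; nra.
apply: le_trans (_ : t `^ nu * (1 + t) `^ nu <= _).
  rewrite ler_wpM2r ?powR_ge0// ge_min; apply/orP; right.
  rewrite -powR_mulrn//; have [->|tn0] := eqVneq t 0.
    rewrite !powR0// ?gt_eqF// ?(lt_le_trans nu_gt0 num)//.
  by apply: ger_powR => //; rewrite lt_neqAle eq_sym tn0 t0 ltW.
rewrite -(powRM _ t0 (ltW t1)).
apply: mono; first by rewrite mulr_ge0// ltW.
have := sqr_ge0 rho; rewrite /t in t_lt1 t0 *; nra.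
Qed.

(** The integrand is compared with [fPsi (rho w)] rather than with the explicit weight, so that the
    only integral left to evaluate is the known mass of [fPsi]. *)
Lemma quad_form_le (I : finType) (a : I -> R) (p : I -> 'rV[R]_d) (rho G : R) (m : nat) :
  0 < rho -> nu <= m%:R -> 0 <= G ->
  (forall xi, symbol a p xi <= G * Num.min 1 (sqnorm2 xi ^+ m)) ->
  \sum_j \sum_k a j * a k * Psi (rho *: p j - rho *: p k) <=
  G * (2 `^ nu * c2 / c1) * (rho `^ (2 * nu) * rho ^- d).
Proof.
move=> r0 num G0 hG; rewrite -lee_fin.
have [-> mF] := quad_form_integral a (fun i => rho *: p i).
rewrite -nnint_integral//; last by move=> w; rewrite lee_fin mulr_ge0 ?symbol_ge0.
have c20 : 0 <= c2.
  have /andP[h1 h2] := fPsi_bnd 0.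
  have : 0 <= c2 * (1 + sqnorm2 (0 : 'rV[R]_d)) `^ (- nu).
    by apply: le_trans h2; exact: fPsi_ge0.
  by rewrite pmulr_lge0// powR_gt0// ltr_pwDl// sqnorm2_ge0.
pose K := G * (2 `^ nu * c2 / c1) * rho `^ (2 * nu).
have K0 : 0 <= K.
  by rewrite !mulr_ge0 ?powR_ge0// invr_ge0 ltW.
apply: le_trans (_ : nnint (fun w => (K * fPsi (rho *: w))%:E) <= _)%E.
  apply: le_nnint => w; rewrite lee_fin.
  have -> : symbol a (fun i => rho *: p i) w = symbol a p (rho *: w).
    by rewrite /symbol; congr (_ ^+ 2 + _ ^+ 2); apply: eq_bigr => i _; rewrite dotVZ.
  have /andP[_ fub] := fPsi_bnd w; have /andP[flb _] := fPsi_bnd (rho *: w).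
  rewrite sqnorm2Z in flb; have := hG (rho *: w); rewrite sqnorm2Z => hs.
  have hb := bessel_scale_le (sqnorm2_ge0 w) r0 num.
  apply: le_trans (ler_pM (symbol_ge0 _ _ _) (fPsi_ge0 _) hs fub) _.
  have hb2 := ler_wpM2l (mulr_ge0 G0 c20) hb.
  have := ler_wpM2l K0 flb; rewrite mulrA => h3.
  apply: le_trans (le_trans _ hb2) (le_trans _ h3).
    by rewrite le_eqVlt; apply/orP; left; apply/eqP; ring.
  by rewrite le_eqVlt; apply/orP; left; apply/eqP; rewrite /K; field; rewrite gt_eqF.
apply: le_trans (@nnint_scale _ _ (fun w => (K * fPsi w)%:E) _ r0) _.
rewrite nnint_integral; last 2 first.
- by move=> w; rewrite lee_fin mulr_ge0.
- by apply/measurable_EFinP; apply: measurable_funM; [exact: measurable_cst|exact: mfPsi].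
under eq_integral do rewrite EFinM.
rewrite integralZl ?int_fPsi ?mule1; last 2 first.
- exact: measurableT.
- exact: integrable_fPsi.
by rewrite -EFinM lee_fin /K; rewrite le_eqVlt; apply/orP; left; apply/eqP; ring.
Qed.

End SpectralBound.

(** * Elementary inequalities and Taylor remainders of sine and cosine *)

Section Elementary.
Variable R : realType.

Lemma sum_sq_le (I : finType) (x : I -> R) :
  (\sum_i x i) ^+ 2 <= #|I|%:R * \sum_i x i ^+ 2.
Proof.
have : 0 <= \sum_i \sum_j (x i - x j) ^+ 2.
  by apply: sumr_ge0 => i _; apply: sumr_ge0 => j _; exact: sqr_ge0.
set S := \sum_i x i; set S2 := \sum_i x i ^+ 2.
have E i : \sum_j (x i - x j) ^+ 2 = #|I|%:R * x i ^+ 2 + (- (2 * S * x i) + S2).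
  rewrite (eq_bigr (fun j => x i ^+ 2 + (- (2 * x i * x j) + x j ^+ 2))); last first.
    by move=> j _; ring.
  rewrite !big_split /= sumr_const sumrN -mulr_sumr -/S -/S2 mulr_natl; ring.
under eq_bigr do rewrite E.
rewrite !big_split /= sumr_const sumrN -!mulr_sumr -/S -/S2 => h.
suff : 0 <= 2 * (#|I|%:R * S2 - S ^+ 2) by rewrite pmulr_rge0// subr_ge0.
by move: h; rewrite -[S2 *+ _]mulr_natl; congr (0 <= _); ring.
Qed.

Lemma dotV_sq_le (d : nat) (xi u : 'rV[R]_d) (B : R) :
  (forall i, `|u ord0 i| <= B) -> dotV xi u ^+ 2 <= d%:R * B ^+ 2 * sqnorm2 xi.
Proof.
move=> uB; apply: le_trans (sum_sq_le _) _.
rewrite card_ord -mulrA ler_wpM2l// /sqnorm2 mulr_sumr; apply: ler_sum => i _.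
rewrite exprMn mulrC ler_wpM2r ?sqr_ge0// -[leLHS]real_normK ?num_real//.
by rewrite lerXn2r ?nnegrE ?(le_trans _ (uB i)).
Qed.

(** The mean value theorem stands in for integration; the factor [1 / (m + 1)] that it loses is
    harmless. *)
Lemma MVT_pow_le (g dg : R -> R) (m : nat) : g 0 = 0 ->
  (forall x : R, is_derive x (1 : R) g (dg x)) -> (forall x, `|dg x| <= `|x| ^+ m) ->
  forall x, `|g x| <= `|x| ^+ m.+1.
Proof.
move=> g0 dgE dgB x.
have cg a b : {within `[a, b], continuous g}.
  apply: continuous_subspaceT => y; apply: differentiable_continuous.
  by apply/derivable1_diffP; case: (dgE y).
have key c : `|c| <= `|x| -> `|dg c * x| <= `|x| ^+ m.+1.
  move=> cx; rewrite normrM exprSr ler_wpM2r//; apply: le_trans (dgB c) _.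
  by rewrite lerXn2r ?nnegrE.
have [x0|x0] := leP 0 x.
  have [c] := MVT_segment x0 (fun y _ => dgE y) (cg 0 x).
  rewrite in_itv /= g0 !subr0 => /andP[c0 cx] ->; apply: key.
  by rewrite !ger0_norm.
have [c] := MVT_segment (ltW x0) (fun y _ => dgE y) (cg x 0).
rewrite in_itv /= g0 !sub0r => /andP[xc c0] E.
rewrite -normrN E mulrN normrN; apply: key.
by rewrite !ler0_norm ?lerN2// ltW.
Qed.

Lemma is_derive_monomials (a : nat -> R) (m : nat) (x : R) :
  is_derive x 1 (fun y : R => \sum_(k < m) a k / k.+1%:R * y ^+ k.+1)
    (\sum_(k < m) a k * x ^+ k).
Proof.
elim: m => [|m IH].
  rewrite big_ord0 (_ : (fun y => _) = cst 0); first exact: is_derive_cst.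
  by apply/funext => y; rewrite big_ord0.
rewrite big_ord_recr /= (_ : (fun y => _) =
  (fun y : R => \sum_(k < m) a k / k.+1%:R * y ^+ k.+1) +
  (fun y : R => a m / m.+1%:R * y ^+ m.+1)); last first.
  by apply/funext => y; rewrite big_ord_recr.
apply: is_deriveD.
have h := is_deriveX m.+1 (is_derive_id x (1 : R)).
rewrite (_ : (fun y => _) = (a m / m.+1%:R) \*: ((@id R) ^+ m.+1)); last first.
  by apply/funext => y; rewrite /= exprfctE.
apply: is_derive_eq (is_deriveZ (a m / m.+1%:R) h) _; rewrite /= /GRing.scale /=.
by rewrite mulr1 mulrA divfK// pnatr_eq0.
Qed.

(* Integrating the expansion of [sin] gives that of [cos] with one more term and
   conversely, so no explicit coefficient is needed. *)
Lemma trig_taylor (m : nat) : exists A B : nat -> R, forall x,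
  `|cos x - \sum_(k < m) A k * x ^+ k| <= `|x| ^+ m /\
  `|sin x - \sum_(k < m) B k * x ^+ k| <= `|x| ^+ m.
Proof.
elim: m => [|m [A [B AB]]].
  exists (fun=> 0), (fun=> 0) => x; rewrite !big_ord0 !subr0 expr0.
  by split; [exact: cos_max|exact: sin_max].
pose A' (k : nat) : R := if k is k'.+1 then - (B k' / k'.+1%:R) else 1.
pose B' (k : nat) : R := if k is k'.+1 then A k' / k'.+1%:R else 0.
exists A', B' => x.
split.
  pose g := cos + (fun y : R => \sum_(k < m) B k / k.+1%:R * y ^+ k.+1) - cst 1.
  have -> : cos x - \sum_(k < m.+1) A' k * x ^+ k = g x.
    rewrite big_ord_recl expr0 mulr1 /g !fctE.
    have -> : \sum_(i < m) A' (lift ord0 i) * x ^+ lift ord0 i =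
        - \sum_(k < m) B k / k.+1%:R * x ^+ k.+1.
      rewrite -sumrN; apply: eq_bigr => k _.
      by rewrite /A' /= mulNr.
    by rewrite /A' /=; ring.
  apply: (@MVT_pow_le g (fun y => - (sin y - \sum_(k < m) B k * y ^+ k))).
  - rewrite /g !fctE cos0 big1 ?addr0 ?subrr// => k _.
    by rewrite expr0n /= mulr0.
  - move=> y; have h1 := is_derive_cos y; have h2 := is_derive_monomials B m y.
    have h3 := is_deriveB (is_deriveD h1 h2) (is_derive_cst (1 : R) y (1 : R)).
    by apply: is_derive_eq h3 _; rewrite subr0 opprB addrC.
  - by move=> y; rewrite normrN; exact: (AB y).2.
pose g := sin - (fun y : R => \sum_(k < m) A k / k.+1%:R * y ^+ k.+1).
have -> : sin x - \sum_(k < m.+1) B' k * x ^+ k = g x.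
  rewrite big_ord_recl /= mul0r add0r /g !fctE; congr (_ - _).
apply: (@MVT_pow_le g (fun y => cos y - \sum_(k < m) A k * y ^+ k)).
- rewrite /g !fctE sin0 big1 ?subrr// => k _.
  by rewrite expr0n /= mulr0.
- move=> y; exact: is_deriveB (is_derive_sin y) (is_derive_monomials A m y).
- by move=> y; exact: (AB y).1.
Qed.

End Elementary.

(** * Local polynomial reproduction with bounded weights *)

Section NearIdentity.
Variables (R : realType) (I : finType) (A : I -> I -> R).
Hypothesis AId : forall l k, `|A l k - (l == k)%:R| <= (2 * #|I|%:R)^-1.

(** At an index where [|w|] is largest, the deviation from the identity contributes at most half of
    that value, which is absorbed on the left. *)
Lemma near_id_bound (w : I -> R) (b : R) :
  (forall l, `|\sum_k A l k * w k| <= b) -> forall k, `|w k| <= 2 * b.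
Proof.
move=> wb k; have [k0 _ kmax] := @arg_maxP _ _ _ k xpredT (fun k => `|w k|) isT.
apply: le_trans (kmax k isT) _.
have I0 : (0 < #|I|)%N by apply/card_gt0P; exists k.
have h : `|w k0| <= b + `|w k0| / 2.
  have -> : w k0 = \sum_k A k0 k * w k - \sum_k (A k0 k - (k0 == k)%:R) * w k.
    rewrite -sumrB (bigD1 k0)//= eqxx big1 ?addr0; first by rewrite mulr1n; ring.
    by move=> j /negbTE jk0; rewrite eq_sym jk0 subr0 subrr.
  apply: le_trans (ler_normB _ _) _; rewrite lerD//.
  apply: le_trans (ler_norm_sum _ _ _) _.
  apply: le_trans (_ : \sum_(j : I) (2 * #|I|%:R)^-1 * `|w k0| <= _).
    by apply: ler_sum => j _; rewrite normrM ler_pM//; exact: kmax.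
  rewrite sumr_const -mulr_natl le_eqVlt; apply/orP; left; apply/eqP.
  have -> : w k0 = \sum_k A k0 k * w k - \sum_k (A k0 k - (k0 == k)%:R) * w k.
    rewrite -sumrB (bigD1 k0)//= eqxx big1 ?addr0; first by rewrite mulr1n; ring.
    by move=> j /negbTE jk0; rewrite eq_sym jk0 subr0 subrr.
  by field; rewrite pnatr_eq0 -lt0n.
lra.
Qed.

(** With right-hand side 0 the preceding bound makes the kernel trivial; with [b] it bounds the
    solution. [I] is enumerated to obtain a square matrix. *)
Lemma near_id_solve (b : I -> R) (c : R) : (forall l, `|b l| <= c) ->
  exists w : I -> R, (forall l, \sum_k A l k * w k = b l) /\ forall k, `|w k| <= 2 * c.
Proof.
move=> bc.
pose M : 'M[R]_#|I| := \matrix_(i, j) A (enum_val i) (enum_val j).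
have sumE l (v : 'I_#|I| -> R) : \sum_k A l k * v (enum_rank k) =
    \sum_(j < #|I|) A l (enum_val j) * v j.
  rewrite (reindex (enum_val : 'I_#|I| -> I)) /=; last exact: onW_bij (enum_val_bij I).
  by apply: eq_bigr => j _; rewrite enum_valK.
have MU : M \in unitmx.
  rewrite -unitmx_tr -row_free_unit; apply: inj_row_free => v vM.
  have w0 : forall k, `|v ord0 (enum_rank k)| <= 2 * 0.
    apply: (@near_id_bound (fun k => v ord0 (enum_rank k))) => l.
    rewrite (sumE l (fun j => v ord0 j)).
    have := congr1 (fun N : 'rV_#|I| => N ord0 (enum_rank l)) vM.
    rewrite !mxE => E.
    have -> : \sum_(j < #|I|) A l (enum_val j) * v ord0 j = 0.
      by apply: etrans E; apply: eq_bigr => j _; rewrite !mxE enum_rankK mulrC.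
    by rewrite normr0.
  apply/rowP => j; rewrite mxE; have := w0 (enum_val j).
  by rewrite enum_valK mulr0 normr_le0 => /eqP.
pose w := invmx M *m \col_(i < #|I|) b (enum_val i).
have wE l : \sum_k A l k * w (enum_rank k) ord0 = b l.
  rewrite (sumE l (fun j => w j ord0)).
  have : (M *m w) (enum_rank l) ord0 = b l by rewrite /w mulKVmx// mxE enum_rankK.
  by rewrite mxE => <-; apply: eq_bigr => j _; rewrite [in RHS]mxE enum_rankK.
exists (fun k => w (enum_rank k) ord0); split=> //.
by apply: near_id_bound => l; rewrite wE.
Qed.

End NearIdentity.

Lemma fin_common_eps (R : realType) (J : finType) (P : J -> R -> Prop) :
  (forall j e e', e' <= e -> P j e -> P j e') ->
  (forall j, exists2 e : R, 0 < e & P j e) -> exists2 e : R, 0 < e & forall j, P j e.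
Proof.
move=> Pm Pe.
suff [e e0 H] : exists2 e : R, 0 < e & forall j, j \in enum J -> P j e.
  by exists e => // j; apply: H; rewrite mem_enum.
elim: (enum J) => [|j s [e e0 H]]; first by exists 1.
have [e' e'0 Pj] := Pe j; exists (Num.min e e').
  by rewrite lt_min e0.
move=> i; rewrite in_cons => /orP[/eqP ->|/H Pi].
  by apply: Pm Pj; rewrite ge_min lexx orbT.
by apply: Pm Pi; rewrite ge_min lexx.
Qed.

Section LocalReproduction.
Variables (R : realType) (d m : nat) (h Kb : R).
Hypotheses (m_gt0 : (0 < m)%N) (h_gt0 : 0 < h) (Kb_ge0 : 0 <= Kb).
Let I := {ffun 'I_d -> 'I_m}.

(** Equispaced nodes in the lower half of [[0, h]]; the other half is left for the perturbation
    radius. *)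
Let tau (a : 'I_m) : R := h / 2 * (a%:R / m%:R).

Let tau_ge0 a : 0 <= tau a.
Proof. by rewrite !mulr_ge0 ?invr_ge0// ltW. Qed.

Let tau_le a : tau a <= h / 2.
Proof.
rewrite ger_pMr ?divr_gt0// ler_pdivrMr ?ltr0n// mul1r ler_nat.
by rewrite ltnW.
Qed.

Let V : 'M[R]_m := Vandermonde m (\row_a tau a).

Let VE k a : V k a = tau a ^+ k.
Proof. by rewrite !mxE. Qed.

Let V_unit : V \in unitmx.
Proof.
rewrite unitmxE unitfE det_Vandermonde; apply/prodf_neq0 => i _.
apply/prodf_neq0 => j ij; rewrite !mxE subr_eq0 /tau.
have h2 : h / 2 != 0 by rewrite gt_eqF// divr_gt0.
have m0 : m%:R^-1 != 0 :> R by rewrite invr_neq0// pnatr_eq0 -lt0n.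
by rewrite (inj_eq (mulfI h2)) (inj_eq (mulIf m0)) eqr_nat gtn_eqF.
Qed.

(** Lagrange basis at the nodes [tau], with coefficients read from the inverse Vandermonde matrix.
    The two products of [V] with its inverse give reproduction of monomials and the delta
    property. *)
Let lag (a : 'I_m) (u : R) : R := \sum_(k < m) invmx V a k * u ^+ k.

Let lag_mono (k : 'I_m) u : \sum_a tau a ^+ k * lag a u = u ^+ k.
Proof.
have := congr1 (fun N : 'cV[R]_m => N k ord0)
  (mulKVmx V_unit (\col_(l < m) u ^+ l)).
rewrite !mxE => <-; apply: eq_bigr => a _; rewrite VE; congr *%R.
by rewrite mxE; apply: eq_bigr => l _; rewrite mxE.
Qed.

Let lag_node a b : lag a (tau b) = (a == b)%:R.
Proof.
have := congr1 (fun N : 'M[R]_m => N a b) (mulVmx V_unit).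
by rewrite !mxE => <-; apply: eq_bigr => k _; rewrite VE.
Qed.

Let tlag (l : I) (x : 'rV[R]_d) : R := \prod_i lag (l i) (x ord0 i).

Let node (k : I) : 'rV[R]_d := \row_i tau (k i).

Let tlag_node l k : tlag l (node k) = (l == k)%:R.
Proof.
rewrite /tlag; under eq_bigr do rewrite mxE lag_node.
have [/forallP H|/forallPn[i li]] := boolP [forall i, l i == k i].
  have -> : l = k by apply/ffunP => i; exact/eqP.
  by rewrite eqxx big1// => i _; rewrite eqxx.
rewrite (bigD1 i)//= (negbTE li) mul0r.
by have /negbTE -> : l != k by apply: contraNneq li => ->.
Qed.

Let tlag_mono (e : 'I_d -> 'I_m) (x : 'rV[R]_d) :
  \prod_i x ord0 i ^+ e i = \sum_(l : I) (\prod_i tau (l i) ^+ e i) * tlag l x.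
Proof.
under eq_bigr do rewrite -lag_mono.
rewrite (bigA_distr_bigA (fun i a => tau a ^+ e i * lag a (x ord0 i))) /=.
by apply: eq_bigr => l _; rewrite big_split.
Qed.

(** Expanding the power over all maps ['I_k -> 'I_d] gives monomials whose exponent in each
    coordinate is at most [k < m], hence in the span of the tensor Lagrange basis. *)
Let tlag_pow (xi : 'rV[R]_d) (k : nat) : (k < m)%N ->
  exists g : I -> R, forall x, dotV xi x ^+ k = \sum_l g l * tlag l x.
Proof.
move=> km.
(* Exponent of coordinate [i] in the monomial selected by [f]. *)
pose e (f : {ffun 'I_k -> 'I_d}) (i : 'I_d) : nat := #|[pred j | f j == i]|.
have em f i : (e f i < m)%N.
  by apply: leq_ltn_trans km; rewrite -[leqRHS]card_ord; exact: max_card.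
pose e' f i := Ordinal (em f i).
exists (fun l => \sum_(f : {ffun 'I_k -> 'I_d})
  (\prod_j xi ord0 (f j)) * \prod_i tau (l i) ^+ e' f i) => x.
have -> : dotV xi x ^+ k = \prod_(j < k) \sum_i xi ord0 i * x ord0 i.
  by rewrite prodr_const card_ord.
rewrite (bigA_distr_bigA (fun (j : 'I_k) i => xi ord0 i * x ord0 i)) /=.
under [RHS]eq_bigr do rewrite mulr_suml.
rewrite exchange_big /=; apply: eq_bigr => f _; rewrite big_split /=.
under [RHS]eq_bigr do rewrite -mulrA.
rewrite -mulr_sumr; congr *%R; apply: etrans (tlag_mono (e' f) x) => /=.
rewrite (partition_big (fun j => f j) xpredT)//=; apply: eq_bigr => i _.
rewrite (eq_bigr (fun=> x ord0 i)); last by move=> j /eqP ->.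
by rewrite prodr_const.
Qed.

Let tlag_continuous l : continuous (tlag l).
Proof.
apply: continuous_big; first exact: mul_continuous.
move=> i _; apply: continuous_big; first exact: add_continuous.
move=> k _ x.
apply: (@continuousM _ _ (fun=> invmx V (l i) k) (fun y : 'rV[R]_d => y ord0 i ^+ k)).
  exact: cst_continuous.
apply: (@continuous_comp _ _ _ (fun y : 'rV[R]_d => y ord0 i) (fun t : R => t ^+ k)).
  exact: coord_continuous.
exact: exprn_continuous.
Qed.

Let tlag_near (eta : R) : 0 < eta -> exists2 e : R, 0 < e & forall (lk : I * I) (u : 'rV[R]_d),
  (forall i, `|u ord0 i - node lk.2 ord0 i| <= e) ->
  `|tlag lk.1 u - (lk.1 == lk.2)%:R| <= eta.
Proof.
move=> eta0; apply: (@fin_common_eps _ _ (fun (lk : I * I) e => forall u : 'rV[R]_d,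
  (forall i, `|u ord0 i - node lk.2 ord0 i| <= e) ->
  `|tlag lk.1 u - (lk.1 == lk.2)%:R| <= eta)).
  by move=> lk e e' ee H u ue; apply: H => i; exact: le_trans (ue i) ee.
move=> [l k] /=.
have ct := @tlag_continuous l (node k).
move/cvgrPdist_le : ct => /(_ _ eta0) /nbhs_ballP[e /= e0 H]; exists (e / 2); first by rewrite divr_gt0.
move=> u ue; rewrite distrC -tlag_node; apply: H; split=> // i j; rewrite ord1.
rewrite /ball /= distrC; apply: le_lt_trans (ue j) _.
by rewrite ltr_pdivrMr// ltr_pMr// ltr1n.
Qed.

Let tlag_bounded : exists2 B : R, 0 <= B & forall l (v : 'rV[R]_d),
  (forall i, `|v ord0 i| <= Kb) -> `|tlag l v| <= B.
Proof.
pose la (a : 'I_m) := \sum_(k < m) `|invmx V a k| * Kb ^+ k.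
have la0 a : 0 <= la a by apply: sumr_ge0 => k _; rewrite mulr_ge0// exprn_ge0.
exists (\sum_(l : I) \prod_i la (l i)).
  by apply: sumr_ge0 => l _; exact: prodr_ge0.
move=> l v vK; apply: le_trans (_ : \prod_i la (l i) <= _); last first.
  by rewrite (bigD1 l)//= lerDl; apply: sumr_ge0 => l' _; exact: prodr_ge0.
rewrite normr_prod; apply: ler_prod => i _; rewrite normr_ge0 /=.
apply: le_trans (ler_norm_sum _ _ _) _; apply: ler_sum => k _.
by rewrite normrM ler_wpM2l// normrX lerXn2r ?nnegrE.
Qed.

(** The weights solve [sum_k tlag l (u k) * w k = tlag l v] for all [l]. By continuity the matrix is
    near the identity as soon as each [u k] is within [e] of its node, and the right-hand side is
    bounded on the cube [|v_i| <= Kb]. Powers of [dotV xi] below [m] are combinations of the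
    [tlag l], hence reproduced. *)
Lemma local_reproduction : exists (J : finType) (t : J -> 'rV[R]_d) (e W : R),
  [/\ (0 < #|J|)%N, 0 < e, 0 <= W, forall k i, `|t k ord0 i| + e <= h &
   forall (u : J -> 'rV[R]_d) (v : 'rV[R]_d),
   (forall k i, `|u k ord0 i - t k ord0 i| <= e) -> (forall i, `|v ord0 i| <= Kb) ->
   exists w : J -> R, (forall k, `|w k| <= W) /\
   forall (xi : 'rV[R]_d) (n : nat), (n < m)%N ->
     \sum_k w k * dotV xi (u k) ^+ n = dotV xi v ^+ n].
Proof.
have I0 : (0 < #|{: I}|)%N.
  by apply/card_gt0P; exists [ffun=> Ordinal m_gt0].
have eta0 : 0 < (2 * #|{: I}|%:R)^-1 :> R by rewrite invr_gt0 mulr_gt0// ltr0n.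
have [e e0 He] := tlag_near eta0; have [B B0 HB] := tlag_bounded.
exists I, node, (Num.min e (h / 2)), (2 * B); split => //.
- by rewrite lt_min e0 divr_gt0.
- by rewrite mulr_ge0.
- move=> k i; rewrite mxE ger0_norm//.
  have h1 : Num.min e (h / 2) <= h / 2 by rewrite ge_min lexx orbT.
  by have := tau_le (k i); lra.
move=> u v uk vK.
have An l k : `|tlag l (u k) - (l == k)%:R| <= (2 * #|{: I}|%:R)^-1.
  apply: (He (l, k)) => i /=; apply: le_trans (uk k i) _.
  by rewrite ge_min lexx.
have [w [wE wB]] := near_id_solve An (fun l => HB l v vK).
exists w; split=> // xi n nm; have [g gE] := tlag_pow xi nm.
under eq_bigr do rewrite gE mulr_sumr.
rewrite gE exchange_big /=; apply: eq_bigr => l _.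
by rewrite -wE mulr_sumr; apply: eq_bigr => k _; ring.
Qed.

End LocalReproduction.

(** As the moments below [m] vanish, cosine and sine may be replaced by their Taylor remainders, of
    size at most [r^m]; left as they are, they are bounded by 1. This gives the two arguments of the
    minimum, and the two squares give the factor 2. *)
Lemma trig_sum_le (R : realType) (J : finType) (a theta : J -> R) (r S : R) (m : nat) :
  (forall k, (k < m)%N -> \sum_i a i * theta i ^+ k = 0) ->
  \sum_i `|a i| <= S -> (forall i, `|theta i| <= r) ->
  (\sum_i a i * cos (theta i)) ^+ 2 + (\sum_i a i * sin (theta i)) ^+ 2 <=
  2 * S ^+ 2 * Num.min 1 ((r ^+ m) ^+ 2).
Proof.
move=> a0 aS tr.
have S0 : 0 <= S by apply: le_trans aS; exact: sumr_ge0.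
have bnd (phi : J -> R) (b : R) : 0 <= b -> (forall i, `|phi i| <= b) ->
    (\sum_i a i * phi i) ^+ 2 <= S ^+ 2 * b ^+ 2.
  move=> b0 pb; rewrite -exprMn -real_normK ?num_real// lerXn2r ?nnegrE ?mulr_ge0//.
  apply: le_trans (ler_norm_sum _ _ _) _.
  apply: le_trans (_ : (\sum_i `|a i|) * b <= _); last exact: ler_wpM2r.
  by rewrite mulr_suml; apply: ler_sum => i _; rewrite normrM ler_wpM2l.
have [A [B AB]] := trig_taylor R m.
have r0 i : `|theta i| ^+ m <= r ^+ m.
  by rewrite lerXn2r ?nnegrE ?(le_trans _ (tr i)).
have sub (phi : R -> R) (C : nat -> R) :
    (forall x, `|phi x - \sum_(k < m) C k * x ^+ k| <= `|x| ^+ m) ->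
    (forall x, `|phi x| <= 1) ->
    (\sum_i a i * phi (theta i)) ^+ 2 <= S ^+ 2 * Num.min 1 ((r ^+ m) ^+ 2).
  move=> pC p1; rewrite minr_pMr ?sqr_ge0// le_min; apply/andP; split.
    by have := bnd (fun i => phi (theta i)) 1 ler01 (fun i => p1 _); rewrite expr1n.
  have -> : \sum_i a i * phi (theta i) =
      \sum_i a i * (phi (theta i) - \sum_(k < m) C k * theta i ^+ k).
    under [RHS]eq_bigr do rewrite mulrBr.
    rewrite sumrB; set z := (X in _ - X); suff -> : z = 0 by rewrite subr0.
    rewrite /z; under eq_bigr do rewrite mulr_sumr.
    rewrite exchange_big big1//= => k _.
    under eq_bigr do rewrite mulrCA.
    by rewrite -mulr_sumr a0// mulr0.
  (* An index shows that [r ^+ m] is nonnegative; over an empty [J] nothing constrains [r], but the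
     sum is 0. *)
  have [i0|nJ] := pselect (exists i : J, true).
    have [i _] := i0.
    apply: bnd => [|j]; first exact: le_trans (exprn_ge0 _ (normr_ge0 (theta i))) (r0 i).
    exact: le_trans (pC _) (r0 j).
  rewrite big1 ?expr0n /=; first by apply: mulr_ge0; exact: sqr_ge0.
  by move=> i _; exfalso; apply: nJ; exists i.
have hc := sub _ _ (fun x => (AB x).1) (@cos_max R).
have hs := sub _ _ (fun x => (AB x).2) (@sin_max R).
by apply: le_trans (lerD hc hs) _; rewrite le_eqVlt; apply/orP; left; apply/eqP; ring.
Qed.

(** * Cubes inside convex sets of positive volume *)

Section ConvexGeometry.
Variables (R : realType) (d : nat) (Om : set 'rV[R]_d).

(** The last point is split off with weight [s] and the other weights are divided by [1 - s]; [v0]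
    takes up the weight missing from 1. *)
Lemma convex_simplex (v0 : 'rV[R]_d) (n : nat) (p : 'I_n -> 'rV[R]_d) (t : 'I_n -> R) :
  convex_set_Rd Om -> Om v0 -> (forall i, Om (v0 + p i)) -> (forall i, 0 <= t i) ->
  \sum_i t i <= 1 -> Om (v0 + \sum_i t i *: p i).
Proof.
move=> cOm Om0; elim: n p t => [|n IH] p t Omp t0 t1.
  by rewrite big_ord0 addr0.
rewrite big_ord_recr /=; rewrite big_ord_recr /= in t1.
set s := t ord_max in t1 *; set S := \sum_(i < n) t (widen_ord (leqnSn n) i) in t1.
have s0 : 0 <= s by exact: t0.
have S0 : 0 <= S by apply: sumr_ge0.
have [s1|s1] := eqVneq s 1.
  have Se0 : S = 0 by apply/eqP; rewrite eq_le S0 andbT; move: t1; rewrite s1; lra.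
  rewrite big1; first by rewrite add0r s1 scale1r.
  move=> i _; have /eqP := Se0; rewrite psumr_eq0// => /allP /(_ i (mem_index_enum _)) /eqP -> .
  by rewrite scale0r.
have s1' : 0 < 1 - s by rewrite subr_gt0 lt_neqAle s1 /=; lra.
have -> : v0 + (\sum_(i < n) t (widen_ord (leqnSn n) i) *: p (widen_ord (leqnSn n) i)
    + s *: p ord_max) =
  s *: (v0 + p ord_max) + (1 - s) *: (v0 + \sum_(i < n)
    (t (widen_ord (leqnSn n) i) / (1 - s)) *: p (widen_ord (leqnSn n) i)).
  rewrite [X in _ = _ + X]scalerDr scaler_sumr.
  rewrite [X in _ = _ + (_ + X)](eq_bigr (fun i : 'I_n =>
     t (widen_ord (leqnSn n) i) *: p (widen_ord (leqnSn n) i))); last first.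
    by move=> i _; rewrite scalerA mulrC divfK// gt_eqF.
  rewrite scalerDr addrACA -scalerDl (addrC s) subrK scale1r.
  by rewrite [X in _ = _ + X]addrC.
apply: cOm => //; last by rewrite s0 /=; lra.
apply: IH => [i|i|]; first exact: Omp.
  by rewrite divr_ge0// ltW.
by rewrite -mulr_suml -/S ler_pdivrMr// mul1r; lra.
Qed.

(** Greedy choice: while there are fewer than [d] rows, a nonzero column of [cokermx V] is normal to
    all of them, and a point of [Om] off the hyperplane through [v0] with this normal supplies the
    next row. *)
Lemma affine_basis (v0 : 'rV[R]_d) :
  (forall (a : 'rV[R]_d) b, a != 0 -> exists2 x, Om x & dotV x a != b) ->
  exists2 V : 'M[R]_d, V \in unitmx & forall i, Om (v0 + row i V).
Proof.
move=> nhyp.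
suff H k : (k <= d)%N ->
    exists2 V : 'M[R]_(k, d), row_free V & forall i, Om (v0 + row i V).
  by have [V Vf VO] := H d (leqnn d); exists V => //; rewrite -row_free_unit.
elim: k => [_|k IH kd].
  by exists 0; [rewrite /row_free mxrank0|case].
have [V Vf VO] := IH (ltnW kd).
have C0 : cokermx V != 0.
  by rewrite -mxrank_eq0 mxrank_coker (eqP Vf) subn_eq0 -ltnNge.
have [j aj0] : exists j, col j (cokermx V) != 0.
  apply/existsP; apply: contraNT C0; rewrite negb_exists => /forallP H.
  by apply/eqP/matrixP => i j; have /eqP/colP/(_ i) := negbNE (H j); rewrite !mxE.
set a := col j _ in aj0.
have Va : V *m a = 0 by rewrite /a colE mulmxA mulmx_coker mul0mx.
have aT0 : a^T != 0 by rewrite -[X in _ != X]trmx0 (inj_eq trmx_inj).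
have dotE x : dotV x a^T = (x *m a) ord0 ord0.
  by rewrite mxE; apply: eq_bigr => i _; rewrite mxE.
have [x Omx xa] := nhyp a^T (dotV v0 a^T) aT0.
exists (col_mx (x - v0) V : 'M[R]_(1 + k, d)).
  apply: (@inj_row_free _ (1 + k) d) => v; rewrite -[v]hsubmxK mul_row_col => E.
  have l0 : lsubmx v = 0.
    have := congr1 (fun N => (N *m a) ord0 ord0) E.
    rewrite mulmxDl -!mulmxA Va mulmx0 addr0 mul0mx mxE big_ord1 [RHS]mxE.
    move=> /eqP; rewrite mulf_eq0 => /orP[/eqP l0|].
      by apply/rowP => i; rewrite ord1 l0 mxE.
    by rewrite mulmxBl mxE [X in _ + X]mxE -!dotE subr_eq0 (negbTE xa).
  move: E; rewrite l0 mul0mx add0r => E.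
  have -> : rsubmx v = 0 by apply: (row_free_inj Vf); rewrite E mul0mx.
  by rewrite row_mx0.
have rows (i : 'I_(1 + k)) : Om (v0 + row i (col_mx (x - v0) V)).
  have [i' ->|i' ->] := split_ordP i.
    by rewrite rowKu ord1 row_id addrC subrK.
  by rewrite rowKd.
exact: rows.
Qed.

(** The centre is the barycentre of the simplex, all [d + 1] weights being [1 / D]. The radius is
    such that the coordinates move by at most [1 / D^2]: they stay nonnegative, and the [d] of them
    sum to at most [1 - 1 / D^2]. *)
Lemma simplex_cube (v0 : 'rV[R]_d) (V : 'M[R]_d) :
  convex_set_Rd Om -> Om v0 -> V \in unitmx -> (forall i, Om (v0 + row i V)) ->
  exists (c : 'rV[R]_d) (h : R), 0 < h /\
    forall x : 'rV[R]_d, (forall i, `|x ord0 i - c ord0 i| <= h) -> Om x.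
Proof.
move=> cOm Om0 VU VO.
pose S := \sum_i \sum_j `|invmx V i j|.
have S0 : 0 <= S by apply: sumr_ge0 => i _; exact: sumr_ge0.
pose D : R := d.+1%:R.
have D0 : 0 < D by rewrite ltr0n.
pose t0 : 'rV[R]_d := const_mx D^-1.
pose c := v0 + t0 *m V; pose h := (D ^+ 2 * (S + 1))^-1.
have DS : 0 < D ^+ 2 * (S + 1) by rewrite mulr_gt0 ?exprn_gt0// ltr_wpDl.
exists c, h; split; first by rewrite invr_gt0.
move=> x xc; pose del := (x - c) *m invmx V.
have delB j : `|del ord0 j| <= D^-1 ^+ 2.
  rewrite mxE; apply: le_trans (ler_norm_sum _ _ _) _.
  apply: le_trans (_ : h * S <= _); last first.
    rewrite /h invfM exprVn -mulrA ler_piMr ?invr_ge0 ?exprn_ge0 ?(ltW D0)//.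
    by rewrite mulrC ler_pdivrMr ?ltr_wpDl// mul1r lerDl.
  rewrite /S mulr_sumr; apply: ler_sum => i _; rewrite normrM.
  have xci := xc i; apply: ler_pM => //; first by rewrite !mxE in xci *.
  by rewrite (bigD1 j)//= lerDl sumr_ge0.
have xE : x = v0 + \sum_i (t0 + del) ord0 i *: row i V.
  have -> : \sum_i (t0 + del) ord0 i *: row i V = (t0 + del) *m V.
    by rewrite mulmx_sum_row.
  by rewrite mulmxDl mulmxKV// addrA /c addrC subrK.
rewrite xE; apply: convex_simplex => //.
  move=> i; rewrite !mxE; have := delB i; rewrite ler_norml => /andP[h1 _].
  rewrite mxE in h1.
  have h2 : D^-1 ^+ 2 <= D^-1.
    by rewrite expr2 ger_pMl ?invr_gt0// invf_le1// /D ler1n.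
  by rewrite -(opprK D^-1) addrC subr_ge0 (le_trans _ h1)// lerN2.
under eq_bigr do rewrite mxE [X in X + _]mxE.
rewrite big_split /= sumr_const card_ord.
have h3 : \sum_(i < d) del ord0 i <= \sum_(i < d) D^-1 ^+ 2.
  by apply: ler_sum => i _; apply: le_trans (ler_norm _) (delB i).
rewrite sumr_const card_ord in h3.
have dD : d%:R = D - 1 :> R by rewrite /D -addn1 natrD addrK.
apply: le_trans (lerD (lexx _) h3) _; rewrite -(mulr_natl D^-1 d) -(mulr_natl (D^-1 ^+ 2) d) dD.
have -> : (D - 1) * D^-1 + (D - 1) * D^-1 ^+ 2 = 1 - (D^-1) ^+ 2.
  by field; rewrite gt_eqF.
by rewrite gerBl sqr_ge0.
Qed.

(** Translates of [Om] by [s k] along a coordinate direction transversal to the hyperplane lie in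
    disjoint measurable slices of one box and all have the outer measure of [Om]; infinitely many of
    them share a finite volume. Additivity is applied to the slices, which are measurable. *)
Lemma hyperplane_lebV0 (K : R) (a : 'rV[R]_d) (b : R) : 0 <= K ->
  (forall x, Om x -> forall i, `|x ord0 i| <= K) -> a != 0 ->
  (forall x, Om x -> dotV x a = b) -> lebV Om = 0%E.
Proof.
move=> K0 OmK a0 Oma.
have [i0 ai0] : exists i, a ord0 i != 0.
  apply/existsP; apply: contraNT a0; rewrite negb_exists => /forallP H.
  by apply/eqP/rowP => i; have /eqP := negbNE (H i); rewrite !mxE.
pose T := caratheodory_type (@lebV R d).
pose Bx : set T := vbox (fun=> - (K + 1)) (fun=> K + 1).
pose s (k : nat) : R := k.+1%:R^-1.
pose F (k : nat) : set T := Bx `&` [set x : 'rV[R]_d | dotV x a = b + s k * a ord0 i0].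
have mBx : measurable Bx by exact: measurable_vbox.
have mF k : measurable (F k).
  apply: measurableI => //.
  have := measurable_dotV a measurableT (measurable_set1 (b + s k * a ord0 i0)).
  by rewrite setTI.
have tF : trivIset setT F.
  apply/trivIsetP => j k _ _ jk; apply/seteqP; split=> // x [[_ /= xj] [_ /= xk]].
  have : s j * a ord0 i0 = s k * a ord0 i0 by apply: (addrI b); rewrite -xj -xk.
  move=> /(mulIf ai0)/invr_inj/eqP.
  by rewrite eqr_nat eqSS (negbTE jk).
have OmF k : (lebV Om <= lebV (F k))%E.
  have := @lebV_affine R d (s k *: delta_mx ord0 i0) 1 Om ltr01.
  rewrite expr1n mul1e => <-; apply: le_lebV => _ [x Omx <-].
  have sk : 0 <= s k <= 1.
    by rewrite invr_ge0 ler0n /= invf_le1// ler1n.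
  split.
    move=> i; rewrite !mxE mul1r eqxx /= -ler_norml.
    apply: le_trans (ler_normD _ _) _; rewrite addrC lerD ?OmK//.
    case/andP: sk => s0 s1; rewrite normrM (ger0_norm s0).
    by case: (i == i0); rewrite /= ?normr1 ?mulr1 ?normr0 ?mulr0.
  rewrite /= -(Oma _ Omx) /dotV addrC.
  have -> : s k * a ord0 i0 = \sum_i (s k *: delta_mx ord0 i0 : 'rV[R]_d) ord0 i * a ord0 i.
    rewrite (bigD1 i0)//= !mxE !eqxx mulr1 big1 ?addr0// => i ii0.
    by rewrite !mxE (negbTE ii0) andbF mulr0 mul0r.
  by rewrite -big_split /=; apply: eq_bigr => i _; rewrite scale1r !mxE; ring.
have BK : (- (K + 1) <= K + 1) by lra.
have VB : (lebV Bx <= (boxvol (fun _ : 'I_d => - (K + 1)) (fun=> K + 1))%:E)%E.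
  by apply: lebV_box => i.
set v := boxvol _ _ in VB.
have v0 : 0 <= v by apply: boxvol_ge0.
have NV (N : nat) : (\sum_(0 <= k < N) lebV Om <= v%:E)%E.
  apply: le_trans VB.
  apply: le_trans (_ : lamV R d (\bigcup_k F k) <= _)%E; last first.
    by apply: le_lebV => x [k _ []].
  rewrite (measure_bigcup (lamV R d) setT F)//.
  apply: le_trans (_ : \sum_(0 <= k < N) lebV (F k) <= _)%E.
    by apply: lee_sum => k _; exact: OmF.
  apply: le_trans (nneseries_lim_ge N _); last by move=> k _ _; exact: lebV_ge0.
  by rewrite [leRHS](eq_bigl xpredT)// => k; rewrite in_setT.
have fOm : lebV Om \is a fin_num.
  rewrite ge0_fin_numE ?lebV_ge0//; apply: le_lt_trans (ltry v).
  by have := NV 1%N; rewrite big_nat1.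
apply/eqP; rewrite eq_le lebV_ge0 andbT leNgt; apply/negP.
rewrite -(fineK fOm) lte_fin; set l := fine _ => l0.
have := NV (Num.trunc (v / l)).+1.
rewrite -(fineK fOm) -/l sumEFin sumr_const_nat subn0 lee_fin.
rewrite -mulr_natl -ler_pdivlMr// leNgt.
by rewrite truncnS_gt.
Qed.

Lemma convex_contains_cube (K : R) : convex_set_Rd Om ->
  (forall x, Om x -> forall i, `|x ord0 i| <= K) -> (0 < lebV Om)%E ->
  exists (c : 'rV[R]_d) (h : R), 0 < h /\
    forall x : 'rV[R]_d, (forall i, `|x ord0 i - c ord0 i| <= h) -> Om x.
Proof.
move=> cOm OmK LOm.
have [v0 Om0] : Om !=set0.
  by apply/set0P; apply: contraTneq LOm => ->; rewrite lebV0 ltxx.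
have OmK' x : Om x -> forall i, `|x ord0 i| <= `|K|.
  by move=> Omx i; apply: le_trans (OmK x Omx i) (ler_norm K).
have [|V VU VO] := @affine_basis v0; last exact: simplex_cube VU VO.
move=> a b a0; apply: contrapT => H; move: LOm.
rewrite (@hyperplane_lebV0 `|K| a b) ?ltxx// => x Omx.
by apply/eqP; apply: contrapT => /negP xa; apply: H; exists x.
Qed.

End ConvexGeometry.

Section Cubes.
Variables (R : realType) (d : nat).

Definition cube (z : 'rV[R]_d) (e : R) : set 'rV[R]_d :=
  [set x | forall i, `|x ord0 i - z ord0 i| <= e].

Lemma cube_vbox z e : cube z e = vbox (fun i => z ord0 i - e) (fun i => z ord0 i + e).
Proof.
apply/seteqP; split=> x H i; have := H i; rewrite ler_distl => /andP[h1 h2].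
  by rewrite h1.
by rewrite h1.
Qed.

Lemma cube_affine (v z : 'rV[R]_d) (t e : R) : 0 < t ->
  affine_image v t (cube z e) = cube (v + t *: z) (t * e).
Proof.
move=> t0; apply/seteqP; split.
  move=> _ [x xz <-] i; rewrite !mxE opprD addrACA subrr add0r -mulrBr normrM.
  by rewrite gtr0_norm// ler_pM2l.
move=> y yz; exists (t^-1 *: (y - v)); last first.
  by rewrite scalerA divff ?gt_eqF// scale1r addrC subrK.
move=> i; have := yz i; rewrite !mxE => h.
have -> : t^-1 * (y ord0 i - v ord0 i) - z ord0 i =
   t^-1 * (y ord0 i - (v ord0 i + t * z ord0 i)) by field; rewrite gt_eqF.
by rewrite normrM gtr0_norm ?invr_gt0// ler_pdivrMl.
Qed.

Lemma leb_measurable_cube z e : leb_measurable_set (cube z e).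
Proof. by rewrite cube_vbox; exact: measurable_vbox. Qed.

Lemma lebV_cube_lty z e : (lebV (cube z e) < +oo)%E.
Proof.
have [e0|e0] := leP 0 e.
  rewrite cube_vbox; apply: le_lt_trans (lebV_box _) (ltry _) => i.
  by lra.
(* For [e < 0] the cube is empty if [d > 0], and the whole one-point space if [d = 0]. *)
have [[i _]|nd] := pselect (exists i : 'I_d, true).
  rewrite (_ : cube z e = set0) ?lebV0 ?ltry//.
  apply/seteqP; split=> // x /(_ i); rewrite leNgt => /negP; apply.
  exact: lt_le_trans e0 _.
apply: le_lt_trans (_ : lebV (cube z 0) < +oo)%E.
  by apply: le_lebV => x _ i; exfalso; apply: nd; exists i.
by rewrite cube_vbox; apply: le_lt_trans (lebV_box _) (ltry _) => i; lra.
Qed.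

End Cubes.

(** * Norm of the error functional of local reproduction *)

Section Interpolation.
Variables (R : realType) (d : nat) (Om : set 'rV[R]_d) (Psi fPsi : 'rV[R]_d -> R).
Variables (c1 c2 nu : R).
Hypotheses (Psi1 : Psi 0 = 1) (sd : spectral_density Psi fPsi).
Hypotheses (c1_gt0 : 0 < c1) (nu_gt0 : 0 < nu).
Hypothesis fPsi_bnd : forall w, c1 * (1 + sqnorm2 w) `^ (- nu) <= fPsi w
  <= c2 * (1 + sqnorm2 w) `^ (- nu).

Lemma min1_scale_le (c x : R) : 0 <= c -> 0 <= x ->
  Num.min 1 (c * x) <= (1 + c) * Num.min 1 x.
Proof.
move=> c0 x0; have [x1|x1] := leP 1 x.
  by rewrite mulr1 (le_trans (_ : _ <= 1)) ?ge_min ?lexx// lerDl.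
by rewrite ge_min; apply/orP; right; rewrite ler_wpM2r// lerDr.
Qed.

(** ['I_1 + I] indexes the error functional: coefficient 1 at the target [v], [- w k] at the nodes,
    so that its moments below [m] vanish. Its l1 norm is at most [1 + #|I| W], and Cauchy-Schwarz
    bounds the phases by a multiple of [|xi|]. *)
Lemma symbol_reproduction_le (I : finType) (u : I -> 'rV[R]_d) (v : 'rV[R]_d)
  (w : I -> R) (W B : R) (m : nat) : 0 <= W ->
  (forall k, `|w k| <= W) ->
  (forall k i, `|u k ord0 i| <= B) -> (forall i, `|v ord0 i| <= B) ->
  (forall (xi : 'rV[R]_d) n, (n < m)%N ->
     \sum_k w k * dotV xi (u k) ^+ n = dotV xi v ^+ n) ->
  forall xi,
  symbol (fun j : 'I_1 + I => if j is inr k then - w k else 1)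
         (fun j => if j is inr k then u k else v) xi <=
  2 * (1 + #|I|%:R * W) ^+ 2 * (1 + (d%:R * B ^+ 2) ^+ m) *
  Num.min 1 (sqnorm2 xi ^+ m).
Proof.
move=> W0 wW uB vB rep xi; set a := (fun j : 'I_1 + I => _); set p := (fun j => _).
pose r := Num.sqrt (d%:R * B ^+ 2 * sqnorm2 xi).
have B20 : 0 <= d%:R * B ^+ 2 by rewrite mulr_ge0// sqr_ge0.
have r2 : r ^+ 2 = d%:R * B ^+ 2 * sqnorm2 xi.
  by rewrite sqr_sqrtr// mulr_ge0// sqnorm2_ge0.
have tr j : `|dotV xi (p j)| <= r.
  rewrite -sqrtr_sqr; apply: ler_wsqrtr; apply: dotV_sq_le => i.
  by case: j => [_|k] /=; [exact: vB|exact: uB].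
apply: le_trans (@trig_sum_le _ _ a (fun j => dotV xi (p j)) r (1 + #|I|%:R * W) m _ _ tr) _.
- move=> n nm; rewrite big_sumType /= big_ord1 mul1r.
  under eq_bigr do rewrite mulNr.
  by rewrite sumrN rep// subrr.
- rewrite big_sumType /= big_ord1 normr1 lerD2l.
  apply: le_trans (_ : \sum_(k : I) W <= _).
    by apply: ler_sum => k _; rewrite normrN.
  by rewrite sumr_const mulr_natl.
rewrite -[leRHS]mulrA ler_wpM2l//; first by rewrite mulr_ge0// sqr_ge0.
rewrite exprAC r2 exprMn; apply: min1_scale_le; rewrite exprn_ge0//.
exact: sqnorm2_ge0.
Qed.

Section Scaled.
Variables (H : set ('rV[R]_d -> R)).
Variable (ip : ('rV[R]_d -> R) -> ('rV[R]_d -> R) -> R).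
Hypothesis HR : is_RKHS Om Psi H ip.
Variables (I : finType) (u : I -> 'rV[R]_d) (v base : 'rV[R]_d).
Variables (w : I -> R) (W B rho : R) (m : nat).
Hypotheses (W_ge0 : 0 <= W) (wW : forall k, `|w k| <= W) (num : nu <= m%:R).
Hypotheses (uB : forall k i, `|u k ord0 i| <= B) (vB : forall i, `|v ord0 i| <= B).
Hypothesis rep : forall (xi : 'rV[R]_d) n, (n < m)%N ->
     \sum_k w k * dotV xi (u k) ^+ n = dotV xi v ^+ n.
Hypotheses (rho_gt0 : 0 < rho).
Hypotheses (uOm : forall k, Om (base + rho *: u k)) (vOm : Om (base + rho *: v)).

(** Constant of the symbol bound times the comparison factor of the two spectral bounds; neither
    [rho] nor the positions of the points enter. *)
Definition repr_const : R :=
  2 * (1 + #|I|%:R * W) ^+ 2 * (1 + (d%:R * B ^+ 2) ^+ m) * (2 `^ nu * c2 / c1).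

Lemma scaled_pointwise_le g : H g ->
  g (base + rho *: v) ^+ 2 <=
  2 * (#|I|%:R * W ^+ 2) * \sum_k g (base + rho *: u k) ^+ 2 +
  2 * (ip g g * (repr_const * (rho `^ (2 * nu) * rho ^- d))).
Proof.
move=> Hg.
pose p (j : 'I_1 + I) : 'rV[R]_d := if j is inr k then u k else v.
pose a (j : 'I_1 + I) : R := if j is inr k then - w k else 1.
have POm j : Om (base + rho *: p j) by case: j => [_|k] /=.
have h1 := functional_le HR a POm Hg.
have B20 : 0 <= d%:R * B ^+ 2 by rewrite mulr_ge0// sqr_ge0.
have G0 : 0 <= 2 * (1 + #|I|%:R * W) ^+ 2 * (1 + (d%:R * B ^+ 2) ^+ m).
  apply: mulr_ge0; first by apply: mulr_ge0 => //; exact: sqr_ge0.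
  by rewrite addr_ge0// exprn_ge0.
have h2 := quad_form_le Psi1 sd c1_gt0 nu_gt0 fPsi_bnd rho_gt0 num G0
  (symbol_reproduction_le W_ge0 wW uB vB rep).
(* [Psi] sees only differences, so the translation by [base] disappears. *)
have h3 : \sum_j \sum_k a j * a k * Psi (base + rho *: p j - (base + rho *: p k)) <=
    repr_const * (rho `^ (2 * nu) * rho ^- d).
  apply: le_trans h2; rewrite le_eqVlt; apply/orP; left; apply/eqP.
  apply: eq_bigr => j _; apply: eq_bigr => k _.
  by rewrite opprD addrACA subrr add0r.
have h4 := le_trans h1 (ler_wpM2l (ip_ge0 HR Hg) h3).
rewrite big_sumType /= big_ord1 mul1r in h4.
set S := \sum_k w k * g (base + rho *: u k).
have hS : S ^+ 2 <= (#|I|%:R * W ^+ 2) * \sum_k g (base + rho *: u k) ^+ 2.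
  apply: le_trans (sum_sq_le _) _; rewrite -mulrA ler_wpM2l// mulr_sumr.
  apply: ler_sum => k _; rewrite exprMn ler_wpM2r ?sqr_ge0//.
  by rewrite -real_normK ?num_real// lerXn2r ?nnegrE.
have E : \sum_i - w i * g (base + rho *: u i) = - S.
  by rewrite /S -sumrN; apply: eq_bigr => k _; rewrite mulNr.
rewrite {}E in h4.
set X := g _ in h4 *.
have h5 : X ^+ 2 <= 2 * (S ^+ 2 + (X - S) ^+ 2).
  by rewrite -subr_ge0 (_ : _ - _ = (X - 2 * S) ^+ 2) ?sqr_ge0//; ring.
apply: le_trans h5 _; apply: le_trans (ler_wpM2l (ler0n R 2) (lerD hS h4)) _.
by rewrite mulrDr (mulrA 2 (#|I|%:R * W ^+ 2)).
Qed.

End Scaled.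
End Interpolation.

(** * Selection of nodes, finite nets and exponents *)

Lemma exists_below_average (R : realType) (n : nat) (A : {set 'I_n}) (F : 'I_n -> R) :
  (0 < #|A|)%N -> (forall j, 0 <= F j) ->
  exists2 j, j \in A & #|A|%:R * F j <= \sum_i F i.
Proof.
move=> /card_gt0P[j0 j0A] F0.
have [j jA jmin] := @arg_minP _ _ _ j0 (mem A) F j0A.
exists j => //; apply: le_trans (_ : \sum_(i in A) F i <= _).
  by rewrite mulr_natl -sumr_const; apply: ler_sum => i iA; exact: jmin.
by rewrite [leRHS](bigID (mem A))/= lerDl sumr_ge0.
Qed.

(** Positive volume makes the norm nonnegative, which the passage to squares requires: on a null
    domain every real would be an essential bound. *)
Lemma linf_norm_sq_le (R : realType) (d : nat) (Om : set 'rV[R]_d) (g : 'rV[R]_d -> R)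
  (M : R) : (0 < lebV Om)%E -> (forall x, Om x -> g x ^+ 2 <= M) ->
  (linf_norm Om g * linf_norm Om g <= M%:E)%E.
Proof.
move=> Om0 gM.
have l0 : (0 <= linf_norm Om g)%E.
  apply: le_ereal_inf_tmp => x /= xM; rewrite leNgt; apply/negP => x0.
  move: Om0; rewrite -xM (_ : [set y | _] = Om) ?xM ?ltxx//.
  apply/seteqP; split=> [y []//|y Omy]; split=> //.
  by apply: lt_le_trans x0 _; rewrite lee_fin.
have [x Omx] : Om !=set0.
  by apply/set0P; apply: contraTneq Om0 => ->; rewrite lebV0 ltxx.
have M0 : 0 <= M by apply: le_trans (gM x Omx); exact: sqr_ge0.
have lM : (linf_norm Om g <= (Num.sqrt M)%:E)%E.
  apply: ereal_inf_lbound => /=; rewrite (_ : [set y | _] = set0) ?lebV0//.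
  apply/seteqP; split=> // y [Omy]; rewrite lte_fin ltNge => /negP; apply.
  by rewrite -sqrtr_sqr; apply: ler_wsqrtr; exact: gM.
apply: le_trans (lee_pmul l0 l0 lM lM) _.
by rewrite -EFinM lee_fin -expr2 sqr_sqrtr.
Qed.

(** Points are sorted by the integer parts of [(x_i + K) / rho], and each nonempty class gets a
    representative in [Om]; an empty class gets the default [x0], which keeps the whole net inside
    [Om]. *)
Lemma finite_net (R : realType) (d : nat) (Om : set 'rV[R]_d) (K rho : R) :
  0 <= K -> 0 < rho -> Om !=set0 -> (forall x, Om x -> forall i, `|x ord0 i| <= K) ->
  exists (M : nat) (b : {ffun 'I_d -> 'I_M} -> 'rV[R]_d),
  [/\ M%:R <= 2 * K / rho + 1, forall g, Om (b g) &
      forall x, Om x -> exists g, forall i, `|x ord0 i - b g ord0 i| <= rho].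
Proof.
move=> K0 r0 [x0 Omx0] OmK.
pose M := (Num.trunc (2 * K / rho)).+1.
pose idx (x : 'rV[R]_d) i := Num.trunc ((x ord0 i + K) / rho).
have pos x i : Om x -> 0 <= (x ord0 i + K) / rho.
  move=> Omx; rewrite divr_ge0 ?(ltW r0)//.
  by have := OmK x Omx i; rewrite ler_norml => /andP[h _]; lra.
have idxM x i : Om x -> (idx x i < M)%N.
  move=> Omx; rewrite ltnS; apply: le_truncn; rewrite ler_pM2r ?invr_gt0//.
  by have := OmK x Omx i; rewrite ler_norml => /andP[_ h]; lra.
pose P (g : {ffun 'I_d -> 'I_M}) x := Om x /\ forall i, idx x i = g i.
pose b g := if pselect (exists x, P g x) is left e then projT1 (cid e) else x0.
exists M, b; split.
- rewrite /M -natr1 lerD2r truncn_le divr_ge0 ?(ltW r0)//.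
  by rewrite mulr_ge0.
- by move=> g; rewrite /b; case: pselect => // e; case: (projT2 (cid e)).
move=> x Omx; exists [ffun i => Ordinal (idxM x i Omx)] => i.
rewrite /b; case: pselect => [e|ne]; last first.
  by exfalso; apply: ne; exists x; split=> // j; rewrite ffunE.
have [Omz /(_ i)] := projT2 (cid e); set z := projT1 _; rewrite ffunE /= => E.
have /truncn_itv/andP[x1 x2] := pos x i Omx.
have /truncn_itv/andP[z1 z2] := pos z i Omz.
move: z1 z2; rewrite -/(idx z i) E => z1 z2.
rewrite -/(idx x i) in x1 x2.
rewrite ler_distl.
move: x1 x2 z1 z2; rewrite !(ler_pdivlMr, ltr_pdivrMr)// -natr1 mulrDl mul1r => x1 x2 z1 z2.
by apply/andP; split; lra.
Qed.

(** From [y <= exp y] at [y = c theta n^theta], raised to the power [1 / theta]. It later absorbs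
    the number of cells into the exponential. *)
Lemma nat_le_expR (R : realType) (c theta : R) : 0 < c -> 0 < theta ->
  exists2 C : R, 0 < C & forall n : nat, n%:R <= C * expR (c * n%:R `^ theta) :> R.
Proof.
move=> c0 t0; pose s := c * theta; have s0 : 0 < s by rewrite mulr_gt0.
exists (s `^ theta^-1)^-1; first by rewrite invr_gt0 powR_gt0.
move=> n; rewrite ler_pdivlMl ?powR_gt0//.
have E : (s * n%:R `^ theta) `^ theta^-1 = s `^ theta^-1 * n%:R.
  rewrite powRM ?powR_ge0 ?(ltW s0)// -powRrM divff ?gt_eqF// powRr1//.
rewrite -E; apply: le_trans (_ : expR (s * n%:R `^ theta) `^ theta^-1 <= _).
  apply: ge0_ler_powR.
  - by rewrite invr_ge0 ltW.
  - by rewrite nnegrE mulr_ge0 ?powR_ge0 ?ltW.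
  - by rewrite nnegrE expR_ge0.
  - apply: le_trans (expR_ge1Dx _); lra.
rewrite -expRM ler_expR le_eqVlt; apply/orP; left; apply/eqP.
by rewrite /s; field; rewrite gt_eqF.
Qed.

Lemma compact_coord_bounded (R : realType) (d : nat) (Om : set 'rV[R]_d) :
  compact Om -> exists2 K : R, 0 <= K & forall x, Om x -> forall i, `|x ord0 i| <= K.
Proof.
move=> /compact_bounded [M [_ HM]]; exists (`|M| + 1); first by rewrite addr_ge0.
move=> x Omx i; apply: le_trans (HM (`|M| + 1) _ x Omx); last first.
  by rewrite (le_lt_trans (ler_norm M))// ltrDl.
rewrite /Num.norm /= mx_normrE.
exact: (le_bigmax _ (fun ij : 'I_1 * 'I_d => `|x ij.1 ij.2|) (ord0, i)).
Qed.

(** All quantities are powers of [n]: [beta < 0] gives [rho <= 1], [alpha - 1 <= beta] the bound on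
    [n^alpha], and [-1 <= beta] with [d < 2 nu] the bound on [rho^-d]. The rate is
    [n^(beta (1 - d / (2 nu)))], one of the two terms of the maximum. *)
Lemma rate_exponents (R : realType) (d n : nat) (alpha nu : R)
    (beta := Num.max (alpha - 1) (-1)) (rho := n%:R `^ (beta / (2 * nu))) :
  (0 < n)%N -> d%:R / 2 < nu -> alpha < 1 ->
  [/\ 0 < rho, rho <= 1, n%:R `^ alpha <= n%:R * rho `^ (2 * nu) &
  [/\ rho `^ (2 * nu) * rho ^- d <=
      Num.max (n%:R `^ ((alpha - 1) * (1 - d%:R / (2 * nu))))
              (n%:R `^ (- (1 - d%:R / (2 * nu)))),
      n%:R * rho ^+ d = n%:R `^ (1 + beta / (2 * nu) * d%:R) &
      rho ^- d <= n%:R]].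
Proof.
move=> n0 dnu al1; set N : R := n%:R.
have N1 : 1 <= N by rewrite /N ler1n.
have N0 : 0 < N by exact: lt_le_trans N1.
have Nn0 : N != 0 by rewrite gt_eqF.
have nu0 : 0 < nu by apply: le_lt_trans dnu; rewrite divr_ge0.
have b0 : beta < 0 by rewrite /beta gt_max; apply/andP; split; lra.
have b1 : -1 <= beta by rewrite /beta le_max lexx orbT.
have nun0 : nu != 0 by rewrite gt_eqF.
have PD r s : N `^ (r + s) = N `^ r * N `^ s by rewrite powRD// Nn0 implybT.
have rnu : rho `^ (2 * nu) = N `^ beta.
  by rewrite /rho -powRrM; congr (_ `^ _); field.
have rd : rho ^+ d = N `^ (beta / (2 * nu) * d%:R).
  by rewrite -powR_mulrn ?powR_ge0// /rho -powRrM.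
have dn : 0 <= d%:R / (2 * nu) <= 1.
  rewrite divr_ge0 ?mulr_ge0 ?(ltW nu0)//= ler_pdivrMr ?mulr_gt0// mul1r.
  by move: dnu; rewrite ltr_pdivrMr// mulrC => /ltW.
case/andP: dn => dn0 dn1.
split.
- by rewrite powR_gt0.
- rewrite /rho -[leRHS](powRr0 N); apply: ler_powR => //.
  by rewrite nmulr_rle0// invr_ge0 mulr_ge0// ltW.
- rewrite rnu -[X in _ <= X * _](powRr1 (ltW N0)) -PD; apply: ler_powR => //.
  by rewrite -lerBlDl /beta le_max lexx.
split.
- rewrite rnu rd -powRN -PD.
  have -> : beta + - (beta / (2 * nu) * d%:R) = beta * (1 - d%:R / (2 * nu)) by field.
  rewrite /beta; have [h|h] := leP (alpha - 1) (-1).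
    by rewrite mulN1r le_max lexx orbT.
  by rewrite le_max lexx.
- by rewrite rd -[X in X * _](powRr1 (ltW N0)) -PD.
- rewrite rd -powRN -[leRHS](powRr1 (ltW N0)); apply: ler_powR => //.
  have -> : - (beta / (2 * nu) * d%:R) = (- beta) * (d%:R / (2 * nu)) by field.
  by rewrite -[leRHS]mulr1; apply: ler_pM => //; lra.
Qed.

(** * Pointwise error when the nearby cells are well filled *)

Section LocalError.
Variables (R : realType) (d : nat) (Om : set 'rV[R]_d) (Psi fPsi : 'rV[R]_d -> R).
Variables (c1 c2 nu : R).
Hypotheses (Psi1 : Psi 0 = 1) (sd : spectral_density Psi fPsi).
Hypotheses (c1_gt0 : 0 < c1) (nu_gt0 : 0 < nu).
Hypothesis fPsi_bnd : forall w, c1 * (1 + sqnorm2 w) `^ (- nu) <= fPsi w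
  <= c2 * (1 + sqnorm2 w) `^ (- nu).
Variables (H : set ('rV[R]_d -> R)).
Variable (ip : ('rV[R]_d -> R) -> ('rV[R]_d -> R) -> R).
Hypothesis HR : is_RKHS Om Psi H ip.
Variables (K h e W : R) (m : nat) (I : finType) (t : I -> 'rV[R]_d) (c : 'rV[R]_d).
Hypotheses (OmK : forall x, Om x -> forall i, `|x ord0 i| <= K) (Omc : Om c).
Hypotheses (K_ge0 : 0 <= K) (h_gt0 : 0 < h) (W_ge0 : 0 <= W) (num : nu <= m%:R).
Hypothesis te : forall k i, `|t k ord0 i| + e <= h.
Hypothesis rep : forall (u : I -> 'rV[R]_d) (v : 'rV[R]_d),
  (forall k i, `|u k ord0 i - t k ord0 i| <= e) ->
  (forall i, `|v ord0 i| <= 2 * K + 1) ->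
  exists w : I -> R, (forall k, `|w k| <= W) /\
  forall (xi : 'rV[R]_d) (n : nat), (n < m)%N ->
    \sum_k w k * dotV xi (u k) ^+ n = dotV xi v ^+ n.

(** Image of the cube of radius [e] at [c + t k] under the homothety of centre [b] and ratio
    [rho]. *)
Definition cell (rho : R) (b : 'rV[R]_d) (k : I) : set 'rV[R]_d :=
  cube ((1 - rho) *: b + rho *: (c + t k)) (rho * e).

Lemma local_error_le (rho : R) (b x : 'rV[R]_d) (n : nat) (X : 'I_n -> 'rV[R]_d)
    (g : 'rV[R]_d -> R) (S M0 : R) :
  0 < rho -> Om b -> Om x -> (forall i, `|x ord0 i - b ord0 i| <= rho) ->
  (forall j, Om (X j)) -> H g -> \sum_j g (X j) ^+ 2 <= S ->
  0 < M0 -> (forall k, M0 <= #|hits (cell rho b k) X|%:R) ->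
  g x ^+ 2 <= 2 * (#|I|%:R * W ^+ 2) * (#|I|%:R * (S / M0)) +
    2 * (ip g g * (repr_const d c1 c2 nu I W (h + (2 * K + 1)) m *
      (rho `^ (2 * nu) * rho ^- d))).
Proof.
move=> r0 Omb Omx xb XOm Hg gS M00 hitsM.
have [K0 h0] := (K_ge0, h_gt0).
have pick k : exists j, cell rho b k (X j) /\ g (X j) ^+ 2 <= S / M0.
  have A0 : (0 < #|hits (cell rho b k) X|)%N.
    by rewrite -(ltr0n R); exact: lt_le_trans (hitsM k).
  have [j jA jle] := exists_below_average A0 (fun j => sqr_ge0 (g (X j))).
  exists j; split; first by move: jA; rewrite finset.in_set => /asboolP.
  rewrite ler_pdivlMr// mulrC; apply: le_trans (le_trans jle gS).
  by rewrite ler_wpM2r// sqr_ge0.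
have [J HJ] := choice pick.
(* [base] is the image of [c]; in the coordinates [rho^-1 (y - base)] the chosen sample points are
   perturbations of the fixed [t k]. *)
pose base := (1 - rho) *: b + rho *: c.
pose u k := rho^-1 *: (X (J k) - base); pose v := rho^-1 *: (x - base).
have rn0 : rho != 0 by rewrite gt_eqF.
have backE y : base + rho *: (rho^-1 *: (y - base)) = y.
  by rewrite scalerA divff// scale1r addrC subrK.
have ut k i : `|u k ord0 i - t k ord0 i| <= e.
  have /(_ i) := (HJ k).1; rewrite !mxE => h1.
  have -> : rho^-1 * (X (J k) ord0 i - ((1 - rho) * b ord0 i + rho * c ord0 i))
      - t k ord0 i = rho^-1 * (X (J k) ord0 i - ((1 - rho) * b ord0 i +
       rho * (c ord0 i + t k ord0 i))) by field.
  by rewrite normrM gtr0_norm ?invr_gt0// ler_pdivrMl.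
(* In these coordinates the target is [(x - b) / rho + (b - c)], which explains the range [2 K + 1]
   demanded in [rep]. *)
have vK i : `|v ord0 i| <= 2 * K + 1.
  rewrite /v /base !mxE.
  have -> : rho^-1 * (x ord0 i - ((1 - rho) * b ord0 i + rho * c ord0 i)) =
     rho^-1 * (x ord0 i - b ord0 i) + (b ord0 i - c ord0 i) by field.
  have h1 : `|rho^-1 * (x ord0 i - b ord0 i)| <= 1.
    by rewrite normrM gtr0_norm ?invr_gt0// ler_pdivrMl// mulr1.
  have h2 : `|b ord0 i - c ord0 i| <= K + K.
    by apply: le_trans (ler_normB _ _) _; apply: lerD; exact: OmK.
  by apply: le_trans (ler_normD _ _) _; lra.
have [w [wW wrep]] := rep ut vK.
have uB k i : `|u k ord0 i| <= h + (2 * K + 1).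
  have -> : u k ord0 i = (u k ord0 i - t k ord0 i) + t k ord0 i by rewrite subrK.
  apply: le_trans (ler_normD _ _) _; apply: le_trans (lerD (ut k i) (lexx _)) _.
  by rewrite addrC; apply: le_trans (te k i) _; rewrite lerDl; lra.
have vB i : `|v ord0 i| <= h + (2 * K + 1) by apply: le_trans (vK i) _; lra.
have uOm k : Om (base + rho *: u k) by rewrite backE.
have vOm : Om (base + rho *: v) by rewrite backE.
have := scaled_pointwise_le Psi1 sd c1_gt0 nu_gt0 fPsi_bnd HR W_ge0 wW num
  uB vB wrep r0 uOm vOm Hg.
rewrite backE => hx; apply: le_trans hx _; rewrite lerD2r ler_wpM2l//.
  by apply: mulr_ge0 => //; apply: mulr_ge0 => //; exact: sqr_ge0.
apply: le_trans (_ : \sum_(k : I) S / M0 <= _); last first.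
  by rewrite sumr_const mulr_natl.
by apply: ler_sum => k _; rewrite backE; exact: (HJ k).2.
Qed.

End LocalError.

(** * Choice of the constants and union bound over the cells *)

Theorem theorem4p6 (R : realType) (d : nat) (Om : set 'rV[R]_d)
  (Psi fPsi : 'rV[R]_d -> R) (c1 c2 nu : R) (f : 'rV[R]_d -> R)
  (alpha : R) (mu : nat -> R) :
  convex_set_Rd Om -> compact Om -> (0 < lebV Om)%E ->
  strictly_pos_def Psi -> leb_integrable Psi -> Psi 0 = 1 ->
  spectral_density Psi fPsi ->
  0 < c1 -> c1 <= c2 -> d%:R / 2 < nu ->
  (forall w, c1 * (1 + sqnorm2 w) `^ (- nu) <= fPsi w <= c2 * (1 + sqnorm2 w) `^ (- nu)) ->
  in_native_space Om Psi f ->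
  alpha < 1 -> (forall n, 0 < mu n) ->
  (exists a b : R, [/\ 0 < a, 0 < b &
     forall n : nat, (0 < n)%N -> a * n%:R `^ alpha <= mu n <= b * n%:R `^ alpha]) ->
  exists C1 C2 C3 eta1 : R, [/\ 0 < C1, 0 < C2, 0 < C3, 0 < eta1 &
    forall n : nat, (0 < n)%N ->
      (lebS [set X : 'I_n -> 'rV[R]_d | (forall j, Om (X j)) /\
          ~ (linf_norm Om (fun x => (f x - krr_estimator Psi (mu n) f X x)%R)
             * linf_norm Om (fun x => (f x - krr_estimator Psi (mu n) f X x)%R)
             <= (C3 * Num.max (n%:R `^ ((alpha - 1) * (1 - d%:R / (2 * nu))))
                              (n%:R `^ (- (1 - d%:R / (2 * nu)))))%R%:E)%E]
       <= (C1 * expR (- (C2 * n%:R `^ eta1)))%R%:E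
          * lebS [set X : 'I_n -> 'rV[R]_d | forall j, Om (X j)])%E].
Proof.
move=> cOm kOm LOm _ _ Psi1 sd c10 c12 dnu fb [H [ip [HR Hf]]] al1 mu0.
move=> [a0 [b0 [_ b0p mub]]].
have nu0 : 0 < nu by apply: le_lt_trans dnu; rewrite divr_ge0.
have [K K0 OmK] := compact_coord_bounded kOm.
have [c [h [h0 ch]]] := convex_contains_cube cOm OmK LOm.
pose m := (Num.trunc nu).+1.
have num : nu <= m%:R by rewrite ltW// truncnS_gt.
have Kb0 : 0 <= 2 * K + 1 by lra.
have [I [t [e [W [N0 e0 W0 te rep]]]]] := @local_reproduction R d m h (2 * K + 1) isT h0 Kb0.
have Omc : Om c by apply: ch => i; rewrite subrr normr0 ltW.
have Omn0 : Om !=set0 by exists c.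
have OmC : Om `<=` cube 0 (K + 1).
  by move=> x Omx i; rewrite mxE subr0 (le_trans (OmK x Omx i))// lerDl.
pose L := fine (lebV Om).
have LE : lebV Om = L%:E.
  rewrite fineK// ge0_fin_numE ?lebV_ge0//.
  by apply: le_lt_trans (le_lebV OmC) _; exact: lebV_cube_lty.
have L0 : 0 < L by rewrite -lte_fin -LE.
(* This volume stays symbolic; it is positive because [Om], of positive volume, lies in a cube. *)
pose lam1 := fine (lebV (cube (0 : 'rV[R]_d) 1)).
have cubeE (z : 'rV[R]_d) r : 0 < r -> lebV (cube z r) = (r ^+ d * lam1)%:E.
  move=> r0; have := cube_affine z 0 1 r0; rewrite scaler0 addr0 mulr1 => <-.
  rewrite lebV_affine// EFinM fineK// ge0_fin_numE ?lebV_ge0//.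
  exact: lebV_cube_lty.
have K10 : 0 < K + 1 by lra.
have lam10 : 0 < lam1.
  have : 0 < (K + 1) ^+ d * lam1.
    by apply: lt_le_trans L0 _; rewrite -lee_fin -LE -(cubeE 0 _ K10); exact: le_lebV.
  by rewrite pmulr_rgt0// exprn_gt0.
(* Share of [Om] taken by a cell at scale 1; at scale [rho] a sample point falls into a given cell
   with probability [q = rho^d q1]. *)
pose q1 := e ^+ d * lam1 / L.
have q10 : 0 < q1 by rewrite !mulr_gt0 ?invr_gt0 ?exprn_gt0.
pose F := ip (restr0 Om f) (restr0 Om f).
have F0 : 0 <= F by exact: ip_ge0 HR _ Hf.
pose N : R := #|I|%:R.
have N0' : 0 < N by rewrite ltr0n.
pose B := h + (2 * K + 1).
pose Cr := repr_const d c1 c2 nu I W B m.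
have Cr0 : 0 <= Cr.
  have B20 : 0 <= d%:R * B ^+ 2 by rewrite mulr_ge0// sqr_ge0.
  apply: mulr_ge0; last by rewrite !mulr_ge0 ?powR_ge0 ?invr_ge0 ?(le_trans (ltW c10))// ltW.
  apply: mulr_ge0; first by apply: mulr_ge0 => //; exact: sqr_ge0.
  by rewrite addr_ge0// exprn_ge0.
pose C3' := F * (8 * N ^+ 2 * W ^+ 2 * b0 / q1 + 2 * Cr).
have C3'0 : 0 <= C3'.
  apply: mulr_ge0 => //; apply: addr_ge0; last by rewrite mulr_ge0.
  by rewrite !mulr_ge0 ?sqr_ge0 ?exprn_ge0 ?invr_ge0 ?(ltW b0p) ?(ltW q10) ?(ltW N0').
pose beta := Num.max (alpha - 1) (-1).
(* Exponent of [n] in [n rho^d]; it serves as [eta1]. *)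
pose theta := 1 + beta / (2 * nu) * d%:R.
have theta0 : 0 < theta.
  have b1 : -1 <= beta by rewrite /beta le_max lexx orbT.
  have dn1 : d%:R / (2 * nu) < 1.
    by rewrite ltr_pdivrMr ?mulr_gt0// mul1r; move: dnu; rewrite ltr_pdivrMr// mulrC.
  have dn0 : 0 <= d%:R / (2 * nu) by rewrite divr_ge0// mulr_ge0// ltW.
  have -> : theta = 1 + beta * (d%:R / (2 * nu)).
    by rewrite /theta; field; rewrite gt_eqF.
  by nra.
(* Half of the Chernoff exponent [q1 / 4]; the other half pays for the number of cells, of order
   [rho^-d <= n]. *)
have q18 : 0 < q1 / 8 by rewrite divr_gt0.
have [C C0 HC] := nat_le_expR q18 theta0.
(* [C3'] vanishes when [f] is zero on [Om], hence [C3' + 1]. *)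
exists (N * (2 * K + 1) ^+ d * C), (q1 / 8), (C3' + 1), theta; split => //.
- by rewrite !mulr_gt0// exprn_gt0//; lra.
- by rewrite ltr_wpDl.
move=> n n0.
have := @rate_exponents R d n alpha nu n0 dnu al1.
rewrite -/beta; set rho := n%:R `^ (beta / (2 * nu)).
move=> [r0 r1 hmu [hrate hnr hrd]].
have [M [b [MK bOm bnet]]] := finite_net K0 r0 Omn0 OmK.
pose Q (gk : {ffun 'I_d -> 'I_M} * I) := cell e t c rho (b gk.1) gk.2.
have QE gk : Q gk = affine_image ((1 - rho) *: b gk.1) rho (cube (c + t gk.2) e).
  by rewrite /Q /cell cube_affine.
have DOm k : cube (c + t k) e `<=` Om.
  move=> x xD; apply: ch => i; have := xD i; rewrite mxE => h1.
  have -> : x ord0 i - c ord0 i = (x ord0 i - (c ord0 i + t k ord0 i)) + t k ord0 i by ring.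
  apply: le_trans (ler_normD _ _) _; apply: le_trans (te k i).
  by rewrite addrC lerD2l.
(* A homothety with centre in the convex set [Om] and ratio at most 1 maps [Om] into itself. *)
have QOm gk : Q gk `<=` Om.
  rewrite QE => _ [x /DOm Omx <-]; rewrite addrC; apply: cOm => //.
  by rewrite (ltW r0).
pose q := rho ^+ d * q1.
have q0 : 0 < q by rewrite mulr_gt0// exprn_gt0.
have LQ gk : lebV (Q gk) = (q * L)%:E.
  rewrite QE lebV_affine// cubeE// -EFinM; congr EFin.
  by rewrite /q /q1; field; rewrite gt_eqF.
have few gk := few_hits_le n (ltW L0) (ltW q0) (QOm gk) (leb_measurable_cube _ _) LE (LQ gk).
have n0' : 0 < n%:R :> R by rewrite ltr0n.
have nq0 : 0 < n%:R * q := mulr_gt0 n0' q0.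
pose Bad gk := [set X : 'I_n -> 'rV[R]_d |
    (forall j, Om (X j)) /\ #|hits (Q gk) X|%:R < n%:R * q / 4].
pose P := rho `^ (2 * nu) * rho ^- d.
have P0 : 0 <= P by rewrite mulr_ge0 ?powR_ge0// invr_ge0 exprn_ge0// ltW.
apply: le_trans (_ : lebS [set X | exists gk, true /\ Bad gk X] <= _)%E.
  apply: le_lebS => X [XOm nle]; apply: contrapT => nB; apply: nle.
  have hitsQ gk : n%:R * q / 4 <= #|hits (Q gk) X|%:R.
    by rewrite leNgt; apply/negP => lt; apply: nB; exists gk.
  apply: linf_norm_sq_le => // x Omx.
  rewrite -(krr_errE Psi X f (mu n) Omx).
  set er := krr_err Om Psi X f (mu n).
  have erN : ip er er <= F := krr_err_norm HR XOm (mu0 n) Hf.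
  (* The net point near [x] selects the cells to use, all of them well filled off the bad events. *)
  have [g xg] := bnet x Omx.
  have hx := local_error_le Psi1 sd c10 nu0 fb HR OmK Omc K0 h0 W0 num te rep r0
    (bOm g) Omx xg XOm (H_krr_err HR (mu n) XOm Hf)
    (krr_err_empirical HR XOm (mu0 n) Hf) (divr_gt0 nq0 (ltr0n R 4))
    (fun k => hitsQ (g, k)).
  apply: le_trans (_ : C3' * P <= _); last first.
    apply: le_trans (_ : (C3' + 1) * P <= _); first by rewrite ler_wpM2r// lerDl.
    by rewrite ler_wpM2l// addr_ge0.
  have muP : mu n * F / (n%:R * q / 4) <= 4 * F * (b0 * P / q1).
    have /andP[_ h1] := mub n n0.
    have alg (a p A s z : R) : A != 0 -> s != 0 ->
        a * (p / A) / s * (z * (A * s)) = a * (z * p).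
      by move=> A0 s0; field; rewrite A0 s0.
    have -> : mu n * F / (n%:R * q / 4) = 4 * F * (mu n / (n%:R * q)).
      by rewrite invfM invrK; ring.
    rewrite ler_wpM2l ?mulr_ge0// (ler_pdivrMr _ _ nq0) alg ?gt_eqF ?exprn_gt0//.
    by apply: le_trans h1 _; rewrite ler_wpM2l// ltW.
  have h1 := ler_wpM2l (mulr_ge0 (mulr_ge0 (ler0n R 2) (mulr_ge0 (ltW N0') (sqr_ge0 W)))
    (ltW N0')) muP.
  have h2 : 2 * (ip er er * (Cr * P)) <= 2 * (F * (Cr * P)).
    by apply: ler_wpM2l => //; apply: ler_wpM2r => //; exact: mulr_ge0.
  apply: le_trans hx _; rewrite -/B -/Cr -/P (mulrA _ #|I|%:R).
  apply: le_trans (lerD h1 h2) _.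
  by rewrite le_eqVlt; apply/orP; left; apply/eqP; rewrite /C3'; ring.
apply: le_trans (outer_measure_exists_le (@lebS R n d) xpredT Bad) _.
apply: le_trans (_ : \sum_(gk : {ffun 'I_d -> 'I_M} * I)
   (expR (- (n%:R * q / 4)) * L ^+ n)%:E <= _)%E.
  by apply: lee_sum => gk _; exact: few.
(* [L ^+ n] bounds the outer measure of the sample space from below, which turns the estimate into
   one relative to that space. *)
apply: le_trans (_ : (N * (2 * K + 1) ^+ d * C * expR (- (q1 / 8 * n%:R `^ theta)))%:E
  * (L ^+ n)%:E <= _)%E; last first.
  apply: lee_wpmul2l; last by apply: lebS_pow_ge; [exact: ltW|rewrite LE].
  by rewrite lee_fin !mulr_ge0 ?expR_ge0 ?exprn_ge0 ?(ltW C0) ?(ltW N0').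
rewrite sumEFin -EFinM lee_fin sumr_const card_prod card_ffun !card_ord.
rewrite -[leLHS]mulr_natl mulrA ler_wpM2r ?exprn_ge0 ?(ltW L0)//.
have nq : n%:R * q = q1 * n%:R `^ theta by rewrite /q mulrA hnr mulrC.
set T := n%:R `^ theta in nq *.
have Mn : M%:R ^+ d <= (2 * K + 1) ^+ d * (C * expR (q1 / 8 * T)).
  apply: le_trans (_ : ((2 * K + 1) / rho) ^+ d <= _).
    rewrite lerXn2r ?nnegrE ?divr_ge0 ?(ltW r0)//; apply: le_trans MK _.
    rewrite ler_pdivlMr// mulrDl divfK ?gt_eqF// mul1r; lra.
  rewrite exprMn exprVn ler_wpM2l ?exprn_ge0//.
  exact: le_trans hrd (HC n).
rewrite natrM natrX -/N nq.
have -> : expR (- (q1 * T / 4)) = expR (- (q1 / 8 * T)) * expR (- (q1 / 8 * T)).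
  by rewrite -expRD; congr expR; field.
have := ler_wpM2r (mulr_ge0 (ltW N0') (mulr_ge0 (expR_ge0 (- (q1 / 8 * T)))
  (expR_ge0 (- (q1 / 8 * T))))) Mn.
rewrite [in X in X <= _]mulrA => /le_trans; apply.
have EE : expR (q1 / 8 * T) * expR (- (q1 / 8 * T)) = 1.
  by rewrite -expRD subrr expR0.
rewrite le_eqVlt; apply/orP; left; apply/eqP.
transitivity (N * (2 * K + 1) ^+ d * C * expR (- (q1 / 8 * T)) *
  (expR (q1 / 8 * T) * expR (- (q1 / 8 * T)))); first by ring.
by rewrite EE mulr1.
Qed.
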